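(* Let $n\ge 1$. Any differential representation $\beta:\mathbf{G}_m^n\to\mathbf{GL}_r$ over $K$ is isomorphic to the direct sum, over $d\in\mathbb{Z}^n$, of its $\chi^d$-isotypic components $$\beta_d:\mathbf{G}_m^n\to\mathbf{GL}_{r_d},\qquad x\mapsto \chi^d(x)\cdot\alpha_d(\lambda(x)),$$ where $\alpha_d:\mathbf{G}_a^n\to\mathbf{GL}_{r_d}$ is a homomorphism of linear differential algebraic groups (defined over $K$). Two representations $\beta,\beta':\mathbf{G}_m^n\to\mathbf{GL}_r$ are equivalent if and only if the corresponding $\alpha_d,\alpha'_d$ are equivalent for all $d\in\mathbb{Z}^n$.
   Context: $K$ is a differential field of characteristic zero with one derivation $\partial$ (also written $'$), not necessarily differentially closed, and $\mathcal{U}\supset K$ is a differentially closed field. Linear differential algebraic groups (Kolchin closed subgroups of $\mathbf{GL}_n(\mathcal{U})$ defined by differential polynomials over $K$) and their homomorphisms (differential polynomial group homomorphisms) are taken over $K$. $\mathbf{G}_m$ is the multiplicative group, with differential coordinate ring $K\{y,1/y\}$, and $\mathbf{G}_a$ the additive group, with differential coordinate ring $K\{y\}$, where $K\{y\}$ is the ring of differential polynomials. A differential representation $G\to\mathbf{GL}_r$ is a homomorphism of linear differential algebraic groups over $K$; equivalence means conjugacy by an element of $\mathbf{GL}_r(K)$. For $d=(d_1,\dots,d_n)\in\mathbb{Z}^n$, $\chi^d:\mathbf{G}_m^n\to\mathbf{G}_m$ is the character $(x_1,\dots,x_n)\mapsto x_1^{d_1}\cdots x_n^{d_n}$. A representation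 is $\chi^d$-isotypic if all its simple subquotients are isomorphic to $\chi^d$. The logarithmic derivative is the homomorphism $\lambda:\mathbf{G}_m^n\to\mathbf{G}_a^n$, $(x_1,\dots,x_n)\mapsto (x_1'/x_1,\dots,x_n'/x_n)$. Here $r_d=0$ for all but finitely many $d$ and $\sum_d r_d=r$. *)

(* Defs.v *)
From HB Require Import structures.
From mathcomp Require Import all_boot all_order all_algebra finmap.
From mathcomp.multinomials Require Import monalg.

Set Implicit Arguments.
Unset Strict Implicit.
Unset Printing Implicit Defensive.

Import GRing.Theory.
Local Open Scope ring_scope.

HB.mixin Record Field_hasDerivation K of GRing.Field K := {
  der : K -> K;
  derD : {morph der : x y / x + y};
  derM : forall x y, der (x * y) = der x * y + x * der y
}.

#[short(type="diffFieldType")]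
HB.structure Definition DiffField :=
  { K of GRing.Field K & Field_hasDerivation K }.

Definition diff_morphism (K L : diffFieldType) (f : {rmorphism K -> L}) : Prop :=
  forall a : K, f (der a) = der (f a).

(* The ring K{y_i | i : I} of differential polynomials, as the polynomial ring
   in the variables (i, j), which stand for the j-th derivative of y_i. *)
Notation dpoly K I := {malg K[{cmonom (I * nat)%type}]}.

Definition deval (K L : diffFieldType) (f : {rmorphism K -> L})
    (I : choiceType) (y : I -> L) (p : dpoly K I) : L :=
  mmap f (fun m : {cmonom (I * nat)%type} =>
    \prod_(v <- finsupp m) iter v.2 der (y v.1) ^+ m v) p.

Definition diff_closed (U : diffFieldType) : Prop :=
  forall (N : nat) (S : seq (dpoly U 'I_N))
         (L : diffFieldType) (f : {rmorphism U -> L}), diff_morphism f ->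
    (exists y : 'I_N -> L, forall p, p \in S -> deval f y p = 0) ->
    exists y : 'I_N -> U, forall p, p \in S -> deval idfun y p = 0.

(* The U-points of a group (the elements of an ambient type that satisfy
   gpoint), its law, and the coordinate functions that generate its differential
   coordinate ring over K as a differential K-algebra. *)
Record dgroup (U : diffFieldType) := DGroup {
  gsort :> Type;
  gpoint : pred gsort;
  gmul : gsort -> gsort -> gsort;
  gidx : choiceType;
  gcoord : gsort -> gidx -> U
}.

(* The coordinates of G_m^n are the y_i and the 1/y_i. *)
Definition Gm (U : diffFieldType) (n : nat) : dgroup U :=
  @DGroup U {ffun 'I_n -> U} (fun x => [forall i, x i != 0]) *%R
    ('I_n + 'I_n)%type
    (fun x k => match k with inl i => x i | inr i => (x i)^-1 end).

Definition Ga (U : diffFieldType) (n : nat) : dgroup U :=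
  @DGroup U {ffun 'I_n -> U} predT +%R 'I_n (fun x i => x i).

Section Representations.
Context (K U : diffFieldType) (iota : {rmorphism K -> U}).

Section OneGroup.
Context (G : dgroup U).

Definition coordinate_function (f : G -> U) : Prop :=
  exists p : dpoly K (gidx G), forall x : G, gpoint x ->
    f x = deval iota (gcoord x) p.

(* The function 1 / det (beta x) = det (beta x^-1) is then a coordinate function
   as well, as G_m^n and G_a^n have inverse maps given by coordinate
   functions. *)
Definition diff_rep r (beta : G -> 'M[U]_r) : Prop :=
  [/\ forall x, gpoint x -> beta x \in unitmx,
      forall x y, gpoint x -> gpoint y -> beta (gmul x y) = beta x *m beta y
    & forall i j, coordinate_function (fun x => beta x i j)].

Definition rep_equiv r1 r2 (beta1 : G -> 'M[U]_r1) (beta2 : G -> 'M[U]_r2) :=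
  exists (e : r1 = r2) (P : 'M[K]_r2), P \in unitmx /\
    forall x, gpoint x ->
      beta2 x = invmx (map_mx iota P) *m castmx (e, e) (beta1 x) *m map_mx iota P.

(* GL_r acts on columns, whereas a subspace of K^r is the row space of a matrix
   W: hence the transposes. *)
Definition subrep r (beta : G -> 'M[U]_r) (W : 'M[K]_r) : Prop :=
  forall x, gpoint x -> stablemx (map_mx iota W) (beta x)^T.

(* tau is the matrix of the action on W2 / W1 in the basis given by the classes
   of the rows of B. *)
Definition subquotient r (beta : G -> 'M[U]_r) (W1 W2 : 'M[K]_r)
    m (tau : G -> 'M[U]_m) : Prop :=
  [/\ subrep beta W1, subrep beta W2, (W1 <= W2)%MS
    & exists B : 'M[K]_(m, r),
      [/\ (W1 + B == W2)%MS, \rank W2 = (\rank W1 + m)%N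
        & forall x, gpoint x ->
            (map_mx iota B *m (beta x)^T - (tau x)^T *m map_mx iota B
               <= map_mx iota W1)%MS]].

Definition simple_rep m (tau : G -> 'M[U]_m) : Prop :=
  (0 < m)%N /\ forall W : 'M[K]_m, subrep tau W -> W = 0 \/ row_full W.

End OneGroup.

Section Torus.
Context (n : nat).

Definition chi (d : {ffun 'I_n -> int}) (x : {ffun 'I_n -> U}) : U :=
  \prod_i x i ^ d i.

Definition logder (x : {ffun 'I_n -> U}) : {ffun 'I_n -> U} :=
  [ffun i => der (x i) / x i].

Definition isotypic d r (beta : Gm U n -> 'M[U]_r) (W : 'M[K]_r) : Prop :=
  forall (W1 W2 : 'M[K]_r) m (tau : Gm U n -> 'M[U]_m),
    (W2 <= W)%MS -> subquotient beta W1 W2 tau -> simple_rep tau ->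
    rep_equiv tau (fun x : Gm U n => (chi d x)%:M : 'M[U]_1).

Definition isotypic_component d r (beta : Gm U n -> 'M[U]_r) (W : 'M[K]_r) :=
  [/\ subrep beta W, isotypic d beta W
    & forall W' : 'M[K]_r, subrep beta W' -> isotypic d beta W' ->
        (W' <= W)%MS].

Definition twist d m (alpha : Ga U n -> 'M[U]_m) : Gm U n -> 'M[U]_m :=
  fun x => chi d x *: alpha (logder x).

Definition direct_sum (s : seq {ffun 'I_n -> int})
    (rd : {ffun 'I_n -> int} -> nat) (B : forall d, Gm U n -> 'M[U]_(rd d)) :
    Gm U n -> 'M[U]_(\sum_(i < size s) rd (s`_i)%R) :=
  fun x => \mxdiag_(i < size s) B s`_i x.

(* beta is isomorphic to the direct sum over d in Z^n of the representations
   x |-> chi^d(x) alpha_d(lambda(x)); s lists the finitely many d for which r_d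
   may be nonzero, and the equality of the dimensions is part of rep_equiv. *)
Definition decomposition r (beta : Gm U n -> 'M[U]_r)
    (s : seq {ffun 'I_n -> int}) (rd : {ffun 'I_n -> int} -> nat)
    (alpha : forall d, Ga U n -> 'M[U]_(rd d)) : Prop :=
  [/\ uniq s, forall d, d \notin s -> rd d = 0%N,
      forall d, diff_rep (alpha d)
    & rep_equiv (direct_sum s (fun d => twist d (alpha d))) beta].

End Torus.
End Representations.

(* Main.v *)
From Stdlib Require Import Classical.
Require Import Defs.
From HB Require Import structures.
From mathcomp Require Import all_boot all_order all_algebra finmap.
From mathcomp Require Import fraction generic_quotient ring.
From mathcomp.multinomials Require Import monalg.

Set Implicit Arguments.
Unset Strict Implicit.
Unset Printing Implicit Defensive.

Import GRing.Theory.
Local Open Scope ring_scope.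

(** The elements x, x', x'', ... and the derivatives of 1/x are x or 1/x times
    differential polynomials in u = x'/x.  A coordinate function of the torus is
    therefore a finite sum of terms chi^d(x) F_d(lambda(x)) with F_d a
    differential polynomial function on G_a^n [Gm_coordinate_expansion].

    This expansion is unique [chi_logder_independent].  Multiplying x by a point
    c with constant coordinates does not change lambda(x) and multiplies chi^d(x)
    by chi^d(c); distinct characters differ already on points with coordinates 1
    and 2, so Dedekind's argument separates the terms.  As U is differentially
    closed, x' = a x has a nonzero solution for every a, so lambda is onto and
    each F_d vanishes on all of G_a^n.

    Write beta(x) = sum_d chi^d(x) B_d(lambda(x)).  Comparing coefficients in
    beta(xy) = beta(x) beta(y) gives B_d(a) B_e(b) = 0 for d <> e and
    B_d(a) B_d(b) = B_d(a + b) [expansion_mul].  Hence the B_d(0) are orthogonal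
    idempotents with sum 1.  They have entries in K, and on the image of B_d(0)
    the function B_d is a representation alpha_d of G_a^n [splitting_exists].
    The same comparison of coefficients shows that an equivalence of beta and
    beta' conjugates B_d into B'_d for every d [splitting_equiv].

    It remains to see that the image of B_d(0) is the chi^d-isotypic component.
    This follows once every nonzero representation of G_a^n over K is known to
    fix a nonzero vector of K^m [Ga_rep_fixed_vector]: then simple subquotients of
    that image are one-dimensional with character chi^d, and every
    subrepresentation with a nonzero projection to the image of B_e(0) contains
    a line on which the torus acts by chi^e.  For the fixed vector, restrict
    alpha to the line of multiples c a with c a natural number: the entries
    become polynomials in c.  The top coefficient of the polynomial vector
    u alpha(c a) is fixed by alpha(a), so by commutativity there is a common
    fixed vector over U.  The linear coefficient of alpha(c a) is a linear
    differential operator in a, whose coefficients are matrices over K.  A vector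
    fixed by alpha is killed by these operators, hence by their coefficient
    matrices, and then some nonzero vector over K is killed as well; finally a
    vector killed by the linear coefficient is fixed, because its orbit
    u(c) has derivative u'(0) alpha(c a) = 0. *)

(** * Differential polynomial functions *)

Section Derivation.
Context (U : diffFieldType).
Implicit Types x y : U.

Lemma der0 : der (0 : U) = 0.
Proof. by apply: (addrI (der 0)); rewrite -derD !addr0. Qed.

Lemma der1 : der (1 : U) = 0.
Proof.
apply: (addrI (der 1)); rewrite addr0 -[RHS]/(der 1) -{3}(mulr1 1) derM.
by rewrite mulr1 mul1r.
Qed.

Lemma der_nat k : der (k%:R : U) = 0.
Proof. by elim: k => [|k IH]; rewrite ?der0 // mulrS derD der1 IH addr0. Qed.

Lemma derV x : x != 0 -> der x^-1 = - (der x / x) * x^-1.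
Proof.
move=> x0; apply: (mulfI x0); apply/eqP; rewrite -subr_eq0.
have /eqP := der1; rewrite -(mulfV x0) derM => /eqP E.
rewrite mulrA mulrN mulrCA mulfV // mulr1 mulNr opprK addrC.
exact/eqP.
Qed.

Lemma iter_derMconst j c x :
  der c = 0 -> iter j der (c * x) = c * iter j der x.
Proof. by move=> c0; elim: j => //= j ->; rewrite derM c0 mul0r add0r. Qed.

End Derivation.

Section CoordinateFunctions.
Context (K U : diffFieldType) (iota : {rmorphism K -> U}) (G : dgroup U).

Section Deval.
Context (I : choiceType) (y : I -> U).

Definition dmonom (m : {cmonom (I * nat)%type}) : U :=
  \prod_(v <- finsupp m) iter v.2 der (y v.1) ^+ m v.

(** Extending the product to a larger finite set lets monomials with different
    supports be compared. *)
Lemma dmonomEw (m : {cmonom (I * nat)%type}) (E : {fset (I * nat)%type}) :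
  (finsupp m `<=` E)%fset ->
  dmonom m = \prod_(v <- E) iter v.2 der (y v.1) ^+ m v.
Proof.
move=> sub; rewrite /dmonom [LHS](big_fset_incl _ sub) // => v _.
by rewrite -cmE_eq0 => /eqP->; rewrite expr0.
Qed.

Lemma dmonom_mmorphism : mmorphism dmonom.
Proof.
split=> [m1 m2|]; last by rewrite /dmonom mdom1 big_seq_fset0.
rewrite (dmonomEw (fsubsetUl (finsupp m1) (finsupp m2))).
rewrite (dmonomEw (fsubsetUr (finsupp m1) (finsupp m2))) -big_split /=.
by rewrite /dmonom mdomD; apply: eq_bigr => v _; rewrite cmM exprD.
Qed.

HB.instance Definition _ := isMultiplicative.Build _ U dmonom dmonom_mmorphism.

Lemma devalD p q : deval iota y (p + q) = deval iota y p + deval iota y q.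
Proof. exact: (rmorphD (mmap iota dmonom)). Qed.

Lemma devalM p q : deval iota y (p * q) = deval iota y p * deval iota y q.
Proof. exact: (rmorphM (mmap iota dmonom)). Qed.

Lemma devalC c : deval iota y c%:MP = iota c.
Proof. exact: (@mmapC _ _ _ iota dmonom). Qed.

Lemma devalX i j : deval iota y << ucm (i, j) >> = iter j der (y i).
Proof.
rewrite [LHS](@mmapU _ _ _ iota dmonom) /= rmorph1 mul1r /dmonom mdomU.
by rewrite big_seq_fset1 cmUU expr1.
Qed.

End Deval.

Local Notation coordinate := (@coordinate_function K U iota G).

Lemma coordinate_ext f g :
  (forall x : G, gpoint x -> f x = g x) -> coordinate f -> coordinate g.
Proof. by move=> fg [p fp]; exists p => x xG; rewrite -fg ?fp. Qed.

Lemma coordinate_const c : coordinate (fun=> iota c).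
Proof. by exists c%:MP => x _; rewrite devalC. Qed.

Lemma coordinate_gen i j : coordinate (fun x => iter j der (gcoord x i)).
Proof. by exists << ucm (i, j) >> => x _; rewrite devalX. Qed.

Lemma coordinateD f g :
  coordinate f -> coordinate g -> coordinate (fun x => f x + g x).
Proof.
by move=> [p fp] [q gq]; exists (p + q) => x xG; rewrite devalD fp ?gq.
Qed.

Lemma coordinateM f g :
  coordinate f -> coordinate g -> coordinate (fun x => f x * g x).
Proof.
by move=> [p fp] [q gq]; exists (p * q) => x xG; rewrite devalM fp ?gq.
Qed.

Lemma coordinate_sum (I : Type) (s : seq I) (P : pred I) (F : I -> G -> U) :
  (forall i, coordinate (F i)) ->
  coordinate (fun x => \sum_(i <- s | P i) F i x).
Proof.
move=> cF; elim: s => [|i s IH].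
  apply: coordinate_ext (coordinate_const 0) => x _.
  by rewrite rmorph0 big_nil.
case Pi: (P i).
  by apply: coordinate_ext (coordinateD (cF i) IH) => x _; rewrite big_cons Pi.
by apply: coordinate_ext IH => x _; rewrite big_cons Pi.
Qed.

(** Coordinate functions are the smallest class of functions that contains the
    constants of K and the derivatives of the coordinates and is closed under sums
    and products; this replaces computations with differential polynomials by
    inductions on functions. *)
Lemma coordinate_ind (P : (G -> U) -> Prop) :
  (forall f g, (forall x : G, gpoint x -> f x = g x) -> P f -> P g) ->
  (forall c, P (fun=> iota c)) ->
  (forall i j, P (fun x => iter j der (gcoord x i))) ->
  (forall f g, P f -> P g -> P (fun x => f x + g x)) ->
  (forall f g, P f -> P g -> P (fun x => f x * g x)) ->
  forall f, coordinate f -> P f.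
Proof.
move=> Pext Pc Pgen PD PM f [p fp].
apply: (Pext (fun x => deval iota (gcoord x) p)) => [x xG|]; first by rewrite fp.
have P0 : P (fun=> 0) by apply: Pext (Pc 0) => x _; rewrite rmorph0.
have P1 : P (fun=> 1) by apply: Pext (Pc 1) => x _; rewrite rmorph1.
rewrite /deval /mmap; elim: (enum_fset (msupp p)) => [|m s IH].
  by apply: Pext P0 => x _; rewrite big_nil.
suff Pm : P (fun x => iota p@_m * dmonom (gcoord x) m).
  by apply: Pext (PD _ _ Pm IH) => x _; rewrite big_cons.
apply: (PM) => //; rewrite /dmonom.
elim: (enum_fset (finsupp m)) => [|[i j] t IHt].
  by apply: Pext P1 => x _; rewrite big_nil.
suff Pv : P (fun x => iter j der (gcoord x i) ^+ m (i, j)).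
  by apply: Pext (PM _ _ Pv IHt) => x _; rewrite big_cons.
elim: (m _) => [|k IHk]; first by apply: Pext P1 => x _; rewrite expr0.
by apply: Pext (PM _ _ (Pgen i j) IHk) => x _; rewrite exprS.
Qed.

Lemma coordinate_der f :
  diff_morphism iota -> coordinate f -> coordinate (fun x => der (f x)).
Proof.
move=> iota_diff cf.
suff [] : coordinate f /\ coordinate (fun x => der (f x)) by [].
elim/coordinate_ind: cf => {f}
  [f g fg [cf cf']|c|i j|f g [cf cf'] [cg cg']|f g [cf cf'] [cg cg']].
- split; first exact: coordinate_ext cf.
  by apply: coordinate_ext cf' => x xG; rewrite fg.
- split; first exact: coordinate_const.
  by apply: coordinate_ext (coordinate_const (der c)) => x _; rewrite iota_diff.
- by split; [exact: coordinate_gen|exact: (coordinate_gen i j.+1)].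
- split; first exact: coordinateD.
  by apply: coordinate_ext (coordinateD cf' cg') => x _; rewrite derD.
- split; first exact: coordinateM.
  apply: coordinate_ext (coordinateD (coordinateM cf' cg) (coordinateM cf cg')).
  by move=> x _; rewrite derM.
Qed.

End CoordinateFunctions.

(** * Differential fields of rational functions *)

Section RationalFunctions.
Context (U : diffFieldType) (g : {poly U}).

Local Notation "p %:F" := (FracField.tofrac p).

Lemma frac_repr (x : {fraction {poly U}}) :
  x = (frac (repr x)).1%:F / (frac (repr x)).2%:F.
Proof.
rewrite -[LHS]reprK; set r := repr x.
rewrite -[RHS]/(FracField.mul (frac r).1%:F (FracField.inv (frac r).2%:F)).
rewrite !piE /FracField.invf /FracField.mulf !numden_Ratio
  ?mulr1 ?mul1r ?oner_eq0 ?denom_ratioP //.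
by rewrite Ratio_numden.
Qed.

Lemma fracP (x : {fraction {poly U}}) :
  exists n d, d != 0 /\ x = n%:F / d%:F.
Proof.
exists (frac (repr x)).1, (frac (repr x)).2; split; last exact: frac_repr.
exact: denom_ratioP.
Qed.

(** The derivation of U[t] that extends the derivation of U and maps t to g. *)
Definition poly_der (p : {poly U}) : {poly U} :=
  \poly_(i < size p) der p`_i + g * p^`().

Lemma coef_der_poly (p : {poly U}) i : (\poly_(i < size p) der p`_i)`_i = der p`_i.
Proof.
rewrite coef_poly; case: ltnP => // ?; by rewrite nth_default // der0.
Qed.

Lemma poly_derD p q : poly_der (p + q) = poly_der p + poly_der q.
Proof.
rewrite /poly_der derivD mulrDr addrACA; congr (_ + _).
by apply/polyP => i; rewrite coefD !coef_der_poly coefD derD.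
Qed.

Lemma der_sum (I : Type) (s : seq I) (F : I -> U) :
  der (\sum_(i <- s) F i) = \sum_(i <- s) der (F i).
Proof. by elim: s => [|i s IH]; rewrite ?big_nil ?der0 // !big_cons derD IH. Qed.

Lemma poly_derM p q : poly_der (p * q) = poly_der p * q + p * poly_der q.
Proof.
rewrite /poly_der derivM.
suff -> : \poly_(i < size (p * q)) der (p * q)`_i
    = (\poly_(i < size p) der p`_i) * q + p * (\poly_(i < size q) der q`_i).
  by ring.
apply/polyP => i; rewrite coef_der_poly coefD !coefM der_sum -big_split /=.
by apply: eq_bigr => j _; rewrite derM !coef_der_poly.
Qed.

Lemma poly_derC c : poly_der c%:P = (der c)%:P.
Proof.
rewrite /poly_der derivC mulr0 addr0; apply/polyP => i.
by rewrite coef_der_poly !coefC; case: eqP => // _; rewrite der0.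
Qed.

Lemma poly_derX : poly_der 'X = g.
Proof.
rewrite /poly_der derivX mulr1 -[RHS]add0r; congr (_ + _); apply/polyP => i.
by rewrite coef_der_poly coefX coef0 der_nat.
Qed.

(** The quotient rule, applied to the chosen representative of a fraction. *)
Definition frac_der (x : {fraction {poly U}}) : {fraction {poly U}} :=
  let r := repr x in
  (poly_der (frac r).1 * (frac r).2 - (frac r).1 * poly_der (frac r).2)%:F
    / ((frac r).2 ^+ 2)%:F.

(** The quotient rule gives the same value on equal fractions, because
    differentiating n b = a d relates the two numerators. *)
Lemma frac_derE n d : d != 0 ->
  frac_der (n%:F / d%:F) = (poly_der n * d - n * poly_der d)%:F / (d ^+ 2)%:F.
Proof.
move=> d0; set x : {fraction {poly U}} := n%:F / d%:F.
rewrite /frac_der; set r := repr x; have r0 : (frac r).2 != 0 by exact: denom_ratioP.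
have xE : x = (frac r).1%:F / (frac r).2%:F by exact: frac_repr.
move: (frac r).1 (frac r).2 r0 xE => a b b0.
rewrite /x => /eqP; rewrite eqr_div ?tofrac_eq0 // -!tofracM tofrac_eq => /eqP E.
apply/eqP; rewrite eqr_div ?tofrac_eq0 ?expf_neq0 // -!tofracM tofrac_eq.
have := congr1 poly_der E; rewrite !poly_derM => E'.
apply/eqP; move: E E'.
move: (poly_der a) (poly_der b) (poly_der n) (poly_der d) => a' b' n' d' E E'.
apply/eqP; rewrite -subr_eq0; apply/eqP.
apply: (@eq_trans _ _ (b * d * ((a' * d + a * d') - (n' * b + n * b'))
   + (n * b - a * d) * (b * d' + b' * d))); first by ring.
by rewrite E E' !subrr mulr0 mul0r addr0.
Qed.

Lemma frac_derD : {morph frac_der : x y / x + y}.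
Proof.
move=> x y; have [a [b [b0 ->]]] := fracP x; have [c [d [d0 ->]]] := fracP y.
have bF : b%:F != 0 by rewrite tofrac_eq0.
have dF : d%:F != 0 by rewrite tofrac_eq0.
rewrite (addf_div _ _ bF dF).
rewrite -!tofracM.
rewrite -tofracD.
rewrite (frac_derE _ (mulf_neq0 b0 d0)).
rewrite (frac_derE _ b0) (frac_derE _ d0).
rewrite [RHS]addf_div ?tofrac_eq0 ?expf_neq0 //.
rewrite -!tofracM -tofracD.
apply/eqP; rewrite eqr_div ?tofrac_eq0 ?mulf_neq0 ?expf_neq0 //.
rewrite -!tofracM.
rewrite tofrac_eq.
rewrite !(poly_derD, poly_derM); apply/eqP; ring.
Qed.

Lemma frac_derM x y : frac_der (x * y) = frac_der x * y + x * frac_der y.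
Proof.
have [a [b [b0 ->]]] := fracP x; have [c [d [d0 ->]]] := fracP y.
have bF : b%:F != 0 by rewrite tofrac_eq0.
have dF : d%:F != 0 by rewrite tofrac_eq0.
rewrite mulf_div -!tofracM !frac_derE ?mulf_neq0 //.
rewrite !mulf_div addf_div -?tofracM ?tofrac_eq0 ?mulf_neq0 ?expf_neq0 //.
rewrite -tofracD.
apply/eqP; rewrite eqr_div ?tofrac_eq0 ?mulf_neq0 ?expf_neq0 // -!tofracM.
by rewrite tofrac_eq !poly_derM; apply/eqP; ring.
Qed.

(** The argument g only selects the derivation: t has derivative g in ratfun g. *)
Definition ratfun of {poly U} := {fraction {poly U}}.
HB.instance Definition _ := GRing.Field.on (ratfun g).
HB.instance Definition _ := Field_hasDerivation.Build (ratfun g) frac_derD frac_derM.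

Definition ratfun_const (c : U) : ratfun g := c%:P%:F.

Fact ratfun_const_zmod : zmod_morphism ratfun_const.
Proof. by move=> x y; rewrite /ratfun_const polyCB tofracB. Qed.
Fact ratfun_const_monoid : monoid_morphism ratfun_const.
Proof. by split=> [|x y]; rewrite /ratfun_const ?tofrac1 // polyCM tofracM. Qed.
HB.instance Definition _ :=
  GRing.isZmodMorphism.Build U (ratfun g) ratfun_const ratfun_const_zmod.
HB.instance Definition _ :=
  GRing.isMonoidMorphism.Build U (ratfun g) ratfun_const ratfun_const_monoid.

Lemma der_ratfun_poly (p : {poly U}) : der (p%:F : ratfun g) = (poly_der p)%:F.
Proof.
have := frac_derE p (oner_neq0 _); rewrite tofrac1 divr1 expr1n tofrac1 divr1 mulr1.
rewrite (_ : poly_der 1 = 0) ?mulr0 ?subr0 //; first by rewrite poly_derC der1.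
Qed.

Lemma ratfun_const_diff : diff_morphism ratfun_const.
Proof. by move=> c; rewrite /= /ratfun_const der_ratfun_poly poly_derC. Qed.

End RationalFunctions.

Section DifferentiallyClosed.
Context (U : diffFieldType) (U_closed : diff_closed U).

Definition dvar (N : nat) (i : 'I_N) j : dpoly U 'I_N := << ucm (i, j) >>.

Lemma deval_var (L : diffFieldType) (f : {rmorphism U -> L}) N (y : 'I_N -> L) i j :
  deval f y (dvar i j) = iter j der (y i).
Proof. exact: devalX. Qed.

(** The equation y' = 1 has the solution t in U(t) with t' = 1. *)
Lemma exists_unit_derivative : exists t : U, der t = 1.
Proof.
pose p : dpoly U 'I_1 := dvar ord0 1 + (-1)%:MP.
have pE (L : diffFieldType) (f : {rmorphism U -> L}) (y : _ -> L) :
    deval f y p = der (y ord0) - 1.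
  rewrite /p devalD; congr (_ + _); first exact: deval_var.
  by rewrite devalC rmorphN1.
have [|y py] := U_closed (S := [:: p]) (@ratfun_const_diff U 1).
  exists (fun=> FracField.tofrac 'X : ratfun 1) => q; rewrite inE => /eqP->.
  by rewrite pE der_ratfun_poly poly_derX tofrac1 subrr.
exists (y ord0); apply/eqP; rewrite -subr_eq0; apply/eqP.
by rewrite -(pE _ idfun) py ?inE.
Qed.

(** The system y' = a y, y z = 1 has the solution (t, 1/t) in U(t) with
    t' = a t; the second equation keeps y away from 0. *)
Lemma exists_logder (a : U) : exists2 x : U, x != 0 & der x / x = a.
Proof.
pose p : dpoly U 'I_2 := dvar ord0 1 + (- a)%:MP * dvar ord0 0.
pose q : dpoly U 'I_2 := dvar ord0 0 * dvar ord_max 0 + (-1)%:MP.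
have pE (L : diffFieldType) (f : {rmorphism U -> L}) (y : _ -> L) :
    deval f y p = der (y ord0) - f a * y ord0.
  rewrite /p devalD -mulNr -rmorphN devalM.
  apply: congr2; first exact: deval_var.
  by apply: congr2; [exact: devalC|exact: deval_var].
have qE (L : diffFieldType) (f : {rmorphism U -> L}) (y : _ -> L) :
    deval f y q = y ord0 * y ord_max - 1.
  rewrite /q devalD devalM -(rmorphN1 f).
  apply: congr2; last exact: devalC.
  by apply: congr2; exact: deval_var.
have [|y py] := U_closed (S := [:: p; q]) (@ratfun_const_diff U (a%:P * 'X)).
  pose t : ratfun (a%:P * 'X) := FracField.tofrac 'X.
  have t0 : t != 0 by rewrite tofrac_eq0 polyX_eq0.
  exists (fun i => if i == ord0 then t else t^-1) => w.
  rewrite !inE => /orP[] /eqP->; rewrite ?pE ?qE /=.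
    by rewrite der_ratfun_poly poly_derX tofracM subrr.
  by rewrite divff // subrr.
have /eqP : deval idfun y p = 0 by apply: py; rewrite !inE eqxx.
have /eqP : deval idfun y q = 0 by apply: py; rewrite !inE eqxx orbT.
rewrite pE qE !subr_eq0 => /eqP y1 /eqP y2.
have y0 : y ord0 != 0.
  by apply: contra_eq_neq y1 => ->; rewrite mul0r eq_sym oner_neq0.
by exists (y ord0) => //; rewrite y2 /= mulfK.
Qed.

End DifferentiallyClosed.

(** * Characters of the torus and the logarithmic derivative *)

Section CharZero.
Context (F : fieldType) (charF : [pchar F] =i pred0).

Lemma natr_eq0_char0 k : (k%:R == 0 :> F) = (k == 0)%N.
Proof. by move/pcharf0P: charF => ->. Qed.

Lemma natr_inj_char0 : injective (fun k => k%:R : F).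
Proof.
move=> j k; wlog le_jk : j k / (j <= k)%N => [H|/eqP].
  by case/orP: (leq_total j k) => [/H//|/H H' /esym /H'].
rewrite eq_sym -subr_eq0 -natrB // natr_eq0_char0 subn_eq0 => le_kj.
by apply/eqP; rewrite eqn_leq le_jk.
Qed.

Lemma exprz2_inj_char0 : injective (fun z : int => (2 : F) ^ z).
Proof.
have two0 : 2 != 0 :> F by rewrite natr_eq0_char0.
have pow1 (z : int) : (2 : F) ^ z = 1 -> z = 0.
  have powN (k : nat) : (2 : F) ^+ k = 1 -> k = 0%N.
    by rewrite -natrX => /(@natr_inj_char0 _ (2 ^ 0)%N) /(@expnI 2 isT).
  case: z => k; first by rewrite -exprnP => /powN ->.
  rewrite NegzE => /(congr1 (@GRing.inv F)); rewrite invr_expz opprK invr1.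
  by rewrite -exprnP => /powN.
move=> y z /= E; apply/eqP; rewrite -subr_eq0; apply/eqP/pow1.
by rewrite expfzDr // E -expfzDr // subrr.
Qed.
End CharZero.

Section Characters.
Context (U : diffFieldType) (n : nat).
Implicit Types (d e : {ffun 'I_n -> int}) (x y c a : {ffun 'I_n -> U}).

Local Notation point := (@gpoint U (Gm U n)).

Lemma GmP x : reflect (forall i, x i != 0) (point x).
Proof. exact: forallP. Qed.

Lemma GmM x y : point x -> point y -> point (x * y).
Proof.
by move=> /GmP x0 /GmP y0; apply/GmP => i; rewrite ffunE mulf_neq0.
Qed.

Lemma Gm1 : point 1.
Proof. by apply/GmP => i; rewrite ffunE oner_neq0. Qed.

Lemma chi_neq0 d x : point x -> chi d x != 0.
Proof. by move=> /GmP x0; apply/prodf_neq0 => i _; rewrite expfz_neq0. Qed.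

Lemma chiM d x y : chi d (x * y) = chi d x * chi d y.
Proof.
by rewrite /chi -big_split; apply: eq_bigr => i _; rewrite ffunE expfzMl.
Qed.

Lemma chi1 d : chi d (1 : {ffun 'I_n -> U}) = 1.
Proof. by apply: big1 => i _; rewrite ffunE exp1rz. Qed.

Lemma chi0 x : chi 0 x = 1.
Proof. by apply: big1 => i _; rewrite ffunE expr0z. Qed.

Lemma chiD d e x : point x -> chi (d + e) x = chi d x * chi e x.
Proof.
move=> /GmP x0; rewrite /chi -big_split; apply: eq_bigr => i _.
by rewrite ffunE expfzDr.
Qed.

Lemma chi_single i (z : int) x : chi [ffun j => if j == i then z else 0] x = x i ^ z.
Proof.
rewrite /chi (bigD1 i) //= ffunE eqxx big1 ?mulr1 // => j /negPf ji.
by rewrite ffunE ji expr0z.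
Qed.

Lemma logderM x y : point x -> point y -> logder (x * y) = logder x + logder y.
Proof.
move=> /GmP x0 /GmP y0; apply/ffunP => i; rewrite !ffunE derM.
by field; rewrite x0 y0.
Qed.

Lemma logder_const c : (forall i, der (c i) = 0) -> logder c = 0.
Proof. by move=> c0; apply/ffunP => i; rewrite !ffunE c0 mul0r. Qed.

Lemma logder1 : logder (1 : {ffun 'I_n -> U}) = 0.
Proof. by apply: logder_const => i; rewrite ffunE der1. Qed.

Lemma logder_surj a : diff_closed U -> exists2 x, point x & logder x = a.
Proof.
move=> U_closed.
have /fin_all_exists2[x x0 xa] i := exists_logder U_closed (a i).
exists [ffun i => x i]; first by apply/GmP => i; rewrite ffunE.
by apply/ffunP => i; rewrite !ffunE.
Qed.

Section Independence.
Context (charU : [pchar U] =i pred0).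

Definition constant_point c := forall i, c i != 0 /\ der (c i) = 0.

(** A point with one coordinate 2 and all others 1 reads off the exponent of that
    coordinate, as the powers of 2 are distinct in characteristic zero. *)
Lemma chi_separated d e :
  d != e -> exists2 c, constant_point c & chi d c != chi e c.
Proof.
move=> de; have [i di] : exists i, d i != e i.
  apply/existsP; apply: contraR de; rewrite negb_exists => /forallP de.
  by apply/eqP/ffunP => i; apply/eqP; move: (de i); rewrite negbK.
pose c : {ffun 'I_n -> U} := [ffun j => if j == i then 2 else 1].
have cE e' : chi e' c = 2 ^ e' i.
  rewrite /chi (bigD1 i) //= ffunE eqxx big1 ?mulr1 // => j /negPf ji.
  by rewrite ffunE ji exp1rz.
exists c => [j|]; last by rewrite !cE (inj_eq (exprz2_inj_char0 charU)).
rewrite ffunE; case: (j == i); last by rewrite oner_neq0 der1.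
by rewrite (natr_eq0_char0 charU 2) (der_nat U 2).
Qed.

(** Dedekind's argument on the constant points: translating a relation by a point
    that separates two of its characters and subtracting cancels one term. *)
Lemma chi_const_independent (s : seq {ffun 'I_n -> int})
    (u : {ffun 'I_n -> int} -> U) :
  uniq s ->
  (forall c, constant_point c -> \sum_(d <- s) u d * chi d c = 0) ->
  forall d, d \in s -> u d = 0.
Proof.
elim: s u => [//|e s IH] u /= /andP[es uniq_s] rel.
have us d : d \in s -> u d = 0.
  move=> ds; have de : d != e by apply: contraNneq es => <-.
  have [c0 c0_const sep] := chi_separated de.
  have /(_ uniq_s _ d ds)/eqP := IH (fun d' => u d' * (chi d' c0 - chi e c0)).
  rewrite mulf_eq0 subr_eq0 (negPf sep) orbF => H; apply/eqP/H => c c_const.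
  have c0c : constant_point (c * c0).
    move=> i; rewrite ffunE derM; have [? ->] := c_const i.
    have [? ->] := c0_const i.
    by rewrite mulr0 mul0r addr0 mulf_neq0.
  transitivity (\sum_(d <- e :: s) u d * chi d (c * c0)
                - chi e c0 * (\sum_(d <- e :: s) u d * chi d c)).
    rewrite mulr_sumr -sumrB big_cons chiM [X in _ = X + _](_ : _ = 0).
      by rewrite add0r; apply: eq_bigr => d' _; rewrite chiM; ring.
    by ring.
  by rewrite !rel // mulr0 subrr.
move=> d; rewrite inE => /orP[/eqP->|/us//].
have c1 : constant_point 1 by move=> i; rewrite ffunE oner_neq0 der1.
move: (rel 1 c1); rewrite big_cons chi1 mulr1 big_seq big1 ?addr0 // => d' d's.
by rewrite us // mul0r.
Qed.

(** On the coset x0 c with c constant, the factors F_d(lambda(x0)) do not vary, so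
    independence over the constants isolates each of them; lambda is onto. *)
Lemma chi_logder_independent (U_closed : diff_closed U)
    (s : seq {ffun 'I_n -> int})
    (F : {ffun 'I_n -> int} -> {ffun 'I_n -> U} -> U) :
  uniq s ->
  (forall x, point x -> \sum_(d <- s) chi d x * F d (logder x) = 0) ->
  forall d a, d \in s -> F d a = 0.
Proof.
move=> uniq_s rel d a ds; have [x x0 <-] := logder_surj a U_closed.
apply: (mulfI (chi_neq0 d x0)); rewrite mulr0.
pose u d := chi d x * F d (logder x).
apply: (chi_const_independent (u := u) uniq_s) => // c c_const.
have c0 : point c by apply/GmP => i; case: (c_const i).
have := rel _ (GmM x0 c0); rewrite logderM // (@logder_const c) ?addr0; last first.
  by move=> i; case: (c_const i).
move=> E; rewrite -[RHS]E; apply: eq_bigr => d' _.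
by rewrite /u chiM; ring.
Qed.

Lemma chi_logder_inj (U_closed : diff_closed U) (s : seq {ffun 'I_n -> int}) p q
    (A B : {ffun 'I_n -> int} -> {ffun 'I_n -> U} -> 'M[U]_(p, q)) :
  uniq s ->
  (forall x, point x -> \sum_(d <- s) chi d x *: A d (logder x)
                      = \sum_(d <- s) chi d x *: B d (logder x)) ->
  forall d a, d \in s -> A d a = B d a.
Proof.
move=> uniq_s AB d a ds; apply/matrixP => i j; apply/eqP; rewrite -subr_eq0; apply/eqP.
pose F d a := A d a i j - B d a i j.
apply: (chi_logder_independent (F := F) U_closed uniq_s) => // x x0.
have /matrixP/(_ i j)/eqP := AB x x0; rewrite -subr_eq0 !summxE -sumrB => /eqP E.
by rewrite -[RHS]E; apply: eq_bigr => d' _; rewrite /F !mxE mulrBr.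
Qed.

End Independence.
End Characters.

(** * Expansion of representations of the torus by characters *)

Lemma big_uniq_subset (V : nmodType) (I : eqType) (s t : seq I) (F : I -> V) :
  uniq s -> uniq t -> {subset s <= t} -> (forall i, i \notin s -> F i = 0) ->
  \sum_(i <- t) F i = \sum_(i <- s) F i.
Proof.
move=> uniq_s uniq_t st F0.
rewrite (bigID (mem s)) /= [X in _ + X]big1 ?addr0 => [|i /F0 //].
rewrite -big_filter; apply/perm_big/uniq_perm; rewrite ?filter_uniq // => i.
by rewrite mem_filter andb_idr //; exact: st.
Qed.

Section TorusCoordinates.
Context (K U : diffFieldType) (iota : {rmorphism K -> U}).
Context (iota_diff : diff_morphism iota) (n : nat).

Local Notation point := (@gpoint U (Gm U n)).
Local Notation Ga_coordinate := (@coordinate_function K U iota (Ga U n)).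

(** The index type is left arbitrary, so that sums and products of functions are
    expanded over disjoint unions and products of index types. *)
Definition chi_expansion (f : Gm U n -> U) :=
  exists (I : finType) (wt : I -> {ffun 'I_n -> int}) (F : I -> Ga U n -> U),
    (forall i, Ga_coordinate (F i)) /\
    forall x, point x -> f x = \sum_i chi (wt i) x * F i (logder x).

Lemma chi_expansion1 f d F : Ga_coordinate F ->
  (forall x, point x -> f x = chi d x * F (logder x)) -> chi_expansion f.
Proof.
move=> cF fE; exists unit, (fun=> d), (fun=> F); split=> // x x0.
by rewrite big_const card_unit /= addr0 fE.
Qed.

(** If h has logarithmic derivative w, then h^(j) = h P_j with P_0 = 1 and
    P_(j+1) = P_j' + w P_j. *)
Lemma iter_der_exponential (h : Gm U n -> U) (w : Ga U n -> U) j :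
  Ga_coordinate w -> (forall x, point x -> der (h x) = h x * w (logder x)) ->
  exists2 P, Ga_coordinate P &
    forall x, point x -> iter j der (h x) = h x * P (logder x).
Proof.
move=> cw hw; elim: j => [|j [P cP PE]].
  exists (fun=> iota 1); first exact: coordinate_const.
  by move=> x _; rewrite rmorph1 mulr1.
exists (fun a => w a * P a + der (P a)).
  exact: coordinateD (coordinateM cw cP) (coordinate_der iota_diff cP).
by move=> x x0; rewrite iterS PE // derM hw // mulrDr mulrA.
Qed.

Lemma Gm_coordinate_expansion f :
  coordinate_function iota f -> chi_expansion f.
Proof.
elim/coordinate_ind => {f} [f g fg|c|k j|f g|f g].
- move=> [I [wt [F [cF fE]]]]; exists I, wt, F; split=> // x x0.
  by rewrite -fg ?fE.
- apply: (chi_expansion1 (d := 0) (coordinate_const iota (Ga U n) c)) => x _.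
  by rewrite chi0 mul1r.
(* The coordinates y_i and 1/y_i have weight 1 and -1 at i, and logarithmic
   derivatives u_i and -u_i. *)
- pose z : int := if k is inl _ then 1 else -1.
  pose i : 'I_n := match k with inl i => i | inr i => i end.
  pose w (a : Ga U n) : U := iota z%:~R * a i.
  have cw : Ga_coordinate w.
    apply: coordinateM (coordinate_const _ _ _) _.
    exact: (coordinate_gen iota (G := Ga U n) i 0).
  have hw x : point x -> der (@gcoord U (Gm U n) x k) = gcoord x k * w (logder x).
    move/GmP=> x0; rewrite /w ffunE rmorph_int /z /i.
    case: k {z i w cw} => i /=; first by field.
    by rewrite derV //; field.
  have [P cP PE] := iter_der_exponential j cw hw.
  apply: (chi_expansion1 (d := [ffun l => if l == i then z else 0]) cP) => x x0.
  by rewrite PE // chi_single /z /i; case: (k) => l /=; rewrite ?expr1z ?exprN1.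
- move=> [I [wt [F [cF fE]]]] [J [wt' [F' [cF' gE]]]].
  exists (I + J)%type, (fun k => match k with inl i => wt i | inr j => wt' j end).
  exists (fun k => match k with inl i => F i | inr j => F' j end).
  by split=> [[]//|x x0]; rewrite big_sumType fE ?gE.
- move=> [I [wt [F [cF fE]]]] [J [wt' [F' [cF' gE]]]].
  exists (I * J)%type, (fun k => wt k.1 + wt' k.2).
  exists (fun k a => F k.1 a * F' k.2 a).
  split=> [k|x x0]; first exact: coordinateM.
  rewrite fE ?gE // big_distrlr pair_bigA /=; apply: eq_bigr => k _.
  by rewrite chiD //; ring.
Qed.

Lemma Gm_coordinate_grouped f : coordinate_function iota f ->
  exists (s : seq {ffun 'I_n -> int}) (F : {ffun 'I_n -> int} -> Ga U n -> U),
    [/\ uniq s, forall d, Ga_coordinate (F d), forall d a, d \notin s -> F d a = 0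
      & forall x, point x -> f x = \sum_(d <- s) chi d x * F d (logder x)].
Proof.
move=> /Gm_coordinate_expansion[I [wt [F [cF fE]]]].
exists (undup (codom wt)), (fun d a => \sum_(i | wt i == d) F i a).
split=> [|d|d a|x x0]; first exact: undup_uniq.
- exact: coordinate_sum.
- rewrite mem_undup => d_notin; apply: big1 => i /eqP dE; case/negP: d_notin.
  by rewrite -dE codom_f.
rewrite fE //; under [RHS]eq_bigr => d _ do rewrite mulr_sumr big_mkcond.
rewrite exchange_big /=; apply: eq_bigr => i _.
rewrite (bigD1_seq (wt i)) ?undup_uniq ?mem_undup ?codom_f //= eqxx.
by rewrite big1 ?addr0 // => d /negPf; rewrite eq_sym => ->.
Qed.

Section Expansion.
Context r (beta : Gm U n -> 'M[U]_r).

(** B is required to vanish off s, so that statements about B d can be made for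
    all d. *)
Definition matrix_expansion (s : seq {ffun 'I_n -> int})
    (B : {ffun 'I_n -> int} -> Ga U n -> 'M[U]_r) :=
  [/\ uniq s, forall d i j, Ga_coordinate (fun a => B d a i j),
      forall d a, d \notin s -> B d a = 0
    & forall x, point x -> beta x = \sum_(d <- s) chi d x *: B d (logder x)].

Lemma matrix_coordinate_expansion :
  (forall i j, coordinate_function iota (fun x => beta x i j)) ->
  exists s B, matrix_expansion s B.
Proof.
move=> cb.
have /fin_all_exists[sF sFE] (ij : 'I_r * 'I_r) :
    exists sF : seq {ffun 'I_n -> int} * ({ffun 'I_n -> int} -> Ga U n -> U),
    [/\ uniq sF.1, forall d, Ga_coordinate (sF.2 d),
        forall d a, d \notin sF.1 -> sF.2 d a = 0
      & forall x, point x ->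
          beta x ij.1 ij.2 = \sum_(d <- sF.1) chi d x * sF.2 d (logder x)].
  by have [s [F H]] := Gm_coordinate_grouped (cb ij.1 ij.2); exists (s, F).
pose s := undup (flatten [seq (sF ij).1 | ij : 'I_r * 'I_r]).
have sub ij : {subset (sF ij).1 <= s}.
  move=> d d_in; rewrite mem_undup; apply/flatten_mapP.
  by exists ij; rewrite ?mem_enum.
exists s, (fun d a => \matrix_(i, j) (sF (i, j)).2 d a).
split=> [|d i j|d a d_notin|x x0]; first exact: undup_uniq.
- have [_ cF _ _] := sFE (i, j).
  by apply: coordinate_ext (cF d) => a _; rewrite mxE.
- apply/matrixP => i j; have [_ _ F0 _] := sFE (i, j).
  by rewrite !mxE F0 //; apply: contra d_notin; exact: sub.
apply/matrixP => i j; have [uniq_s _ F0 bE] := sFE (i, j).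
rewrite summxE (bE x x0).
rewrite -(@big_uniq_subset _ _ _ s) ?undup_uniq //; last first.
  by move=> d /F0 ->; rewrite mulr0.
by apply: eq_bigr => d _; rewrite !mxE.
Qed.

End Expansion.

Lemma Ga_coordinate_at0 f : Ga_coordinate f -> exists c, f 0 = iota c.
Proof.
elim/coordinate_ind => {f}
  [f g fg [c fc]|c|i j|f g [c fc] [c' gc]|f g [c fc] [c' gc]].
- by exists c; rewrite -fg.
- by exists c.
- exists 0; rewrite rmorph0 /= ffunE.
  by elim: j => //= j ->; rewrite der0.
- by exists (c + c'); rewrite rmorphD fc gc.
- by exists (c * c'); rewrite rmorphM fc gc.
Qed.

Section Homomorphism.
Context (charU : [pchar U] =i pred0) (U_closed : diff_closed U).
Context r (beta : Gm U n -> 'M[U]_r) (s : seq {ffun 'I_n -> int})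
        (B : {ffun 'I_n -> int} -> Ga U n -> 'M[U]_r).
Hypothesis beta_rep : diff_rep iota beta.
Hypothesis betaE : matrix_expansion beta s B.

(** The expansion of beta(xy) = beta(x) beta(y) is compared twice, first in x for
    fixed y and then in y. *)
Lemma expansion_mul d e a b : B d a *m B e b = if d == e then B d (a + b) else 0.
Proof.
have [uniq_s _ B0 bE] := betaE; have [_ bM _] := beta_rep.
have [ds|/B0 Bd0] := boolP (d \in s); last first.
  by rewrite !Bd0 mul0mx if_same.
have [es|/[dup] es /B0 Be0] := boolP (e \in s); last first.
  by rewrite Be0 mulmx0 ifN //; apply: contraNneq es => <-.
have key y : point y -> B d a *m beta y = chi d y *: B d (a + logder y).
  move=> y0.
  apply: (chi_logder_inj charU U_closed (A := fun d a => B d a *m beta y)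
    (B := fun d a => chi d y *: B d (a + logder y)) uniq_s) => // x x0.
  transitivity (beta x *m beta y).
    by rewrite (bE x x0) mulmx_suml; apply: eq_bigr => d' _; rewrite -scalemxAl.
  rewrite -(bM x y) // bE ?GmM //; apply: eq_bigr => d' _.
  by rewrite chiM logderM // scalerA.
apply: (chi_logder_inj charU U_closed (A := fun e b => B d a *m B e b)
          (B := fun e b => if d == e then B d (a + b) else 0) uniq_s) => // y y0.
transitivity (B d a *m beta y).
  by rewrite bE // mulmx_sumr; apply: eq_bigr => e' _; rewrite -scalemxAr.
rewrite key // (bigD1_seq d) //= eqxx big1 ?addr0 // => e' /negPf.
by rewrite eq_sym => ->; rewrite scaler0.
Qed.

Lemma expansion_sum0 : \sum_(d <- s) B d 0 = 1%:M.
Proof.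
have [uniq_s _ B0 bE] := betaE; have [bU bM _] := beta_rep.
have b1 : beta 1 = 1%:M.
  have := bM 1 1 (Gm1 U n) (Gm1 U n).
  rewrite /= mulr1 => /(congr1 (mulmx (invmx (beta 1)))).
  by rewrite mulmxA mulVmx ?mul1mx ?bU ?Gm1.
rewrite -b1 bE ?Gm1 // logder1; apply: eq_bigr => d _.
by rewrite chi1 scale1r.
Qed.

End Homomorphism.

End TorusCoordinates.

(** * Fixed vectors of representations of a vector group *)

Section PolynomialsCharZero.
Context (F : fieldType) (charF : [pchar F] =i pred0).
Implicit Types p q : {poly F}.

Lemma poly_nat_eq0 p : (forall c : nat, p.[c%:R] = 0) -> p = 0.
Proof.
move=> p0; apply: (@roots_geq_poly_eq0 _ p [seq c%:R | c <- iota 0 (size p)]).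
- by apply/allP => _ /mapP[c _ ->]; apply/rootP.
- by rewrite map_inj_uniq ?iota_uniq //; exact: natr_inj_char0.
- by rewrite size_map size_iota.
Qed.

Lemma poly_nat_inj p q : (forall c : nat, p.[c%:R] = q.[c%:R]) -> p = q.
Proof.
move=> pq; apply/eqP; rewrite -subr_eq0; apply/eqP/poly_nat_eq0 => c.
by rewrite !hornerE pq subrr.
Qed.

Lemma deriv_eq0_const p : p^`() = 0 -> p = (p`_0)%:P.
Proof.
move=> p'0; apply/polyP => -[|i]; rewrite coefC //=.
have := coef_deriv p i; rewrite p'0 coef0 -mulr_natr => /esym/eqP.
by rewrite mulf_eq0 natr_eq0_char0 // orbF => /eqP.
Qed.

Lemma coef_comp_translate p c D :
  (size p <= D.+1)%N -> (p \Po ('X + c%:P))`_D = p`_D.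
Proof.
have size2 : size ('X + c%:P) = 2 by rewrite size_XaddC.
rewrite leq_eqVlt => /orP[/eqP pD|pD]; last first.
  by rewrite !nth_default ?size_comp_poly2.
have := lead_coef_comp p (q := 'X + c%:P); rewrite size2 => /(_ isT).
rewrite lead_coefXaddC expr1n mulr1 !lead_coefE.
by rewrite size_comp_poly2 // pD.
Qed.

End PolynomialsCharZero.

Section LinearOperators.
Context (U : diffFieldType).
Implicit Types (P Q : {poly U}) (y : U).

(** The polynomial P stands for the linear differential operator P(D), where D is
    the derivation. *)
Definition diffop P y : U := \sum_(j < size P) P`_j * iter j der y.

Lemma diffopEw N P y : (size P <= N)%N ->
  diffop P y = \sum_(j < N) P`_j * iter j der y.
Proof.
move=> PN; rewrite /diffop -(big_mkord xpredT (fun j => P`_j * iter j der y)).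
rewrite -(big_mkord xpredT (fun j => P`_j * iter j der y)).
rewrite [RHS](big_cat_nat (leq0n _) PN) //= [X in _ = _ + X]big1_seq ?addr0 // => j.
by rewrite mem_index_iota => /andP[_ /andP[Pj _]]; rewrite nth_default ?mul0r.
Qed.

Lemma diffop0p y : diffop 0 y = 0.
Proof. by rewrite /diffop size_poly0 big_ord0. Qed.

Lemma diffopD P Q y : diffop (P + Q) y = diffop P y + diffop Q y.
Proof.
rewrite (diffopEw _ (size_polyD P Q)) (diffopEw _ (leq_maxl (size P) (size Q))).
rewrite (diffopEw _ (leq_maxr (size P) (size Q))) -big_split.
by apply: eq_bigr => j _; rewrite coefD mulrDl.
Qed.

Lemma diffopZ c P y : diffop (c *: P) y = c * diffop P y.
Proof.
rewrite !(@diffopEw (size P)) ?size_scale_leq // mulr_sumr.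
by apply: eq_bigr => j _; rewrite coefZ mulrA.
Qed.

Lemma diffop_sum (I : Type) (s : seq I) (F : I -> {poly U}) y :
  diffop (\sum_(i <- s) F i) y = \sum_(i <- s) diffop (F i) y.
Proof.
by elim: s => [|i s IH]; rewrite ?big_nil ?diffop0p // !big_cons diffopD IH.
Qed.

Lemma diffop_0 P : diffop P 0 = 0.
Proof.
apply: big1 => j _; rewrite [iter _ _ _](_ : _ = 0) ?mulr0 //.
by elim: (nat_of_ord j) => //= i ->; rewrite der0.
Qed.

Lemma diffop_Xn j y : diffop 'X^j y = iter j der y.
Proof.
rewrite /diffop size_polyXn big_ord_recr /= coefXn eqxx mul1r big1 ?add0r //.
by move=> i _; rewrite coefXn /= ltn_eqF ?mul0r.
Qed.

Context (t : U) (der_t : der t = 1).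

Lemma iter_derMt j y :
  iter j der (t * y) = t * iter j der y + iter j.-1 der y *+ j.
Proof.
elim: j => [|j IH]; first by rewrite mulr0n addr0.
rewrite iterS IH derD derM der_t mul1r mulrSr -addrA addrC -addrA.
congr (_ + _); congr (_ + _); case: j {IH} => [|j]; first by rewrite !mulr0n der0.
by rewrite -mulr_natr derM der_nat mulr0 addr0 mulr_natr.
Qed.

(** If t' = 1, the commutator of P(D) with multiplication by t is P'(D). *)
Lemma diffopMt P y : diffop P (t * y) = t * diffop P y + diffop P^`() y.
Proof.
rewrite (diffopEw (N := (size P).+1)) // (@diffopEw (size P).+1 P y) //.
rewrite (diffopEw (N := size P)); last first.
  have [->|P0] := eqVneq P 0; first by rewrite derivC size_poly0.
  by rewrite ltnW ?lt_size_deriv.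
rewrite mulr_sumr.
transitivity (\sum_(j < (size P).+1) (t * (P`_j * iter j der y)
                + P`_j * (iter j.-1 der y *+ j))).
  by apply: eq_bigr => j _; rewrite iter_derMt; ring.
rewrite big_split /=; congr (_ + _); rewrite big_ord_recl mulr0n mulr0 add0r.
by apply: eq_bigr => j _; rewrite coef_deriv /= mulrnAr mulrnAl.
Qed.

(** By the commutator formula P'(D) vanishes with P(D), so induction on the degree
    reduces to a constant P, which is evaluated at 1. *)
Lemma diffop_eq0 P : [pchar U] =i pred0 -> (forall y, diffop P y = 0) -> P = 0.
Proof.
move=> charU; have [N] := ubnP (size P); elim: N P => // N IH P sP P0.
have [->//|Pn0] := eqVneq P 0.
have P'0 : P^`() = 0.
  apply: IH => [|y]; first exact: leq_trans (lt_size_deriv Pn0) _.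
  by have := diffopMt P y; rewrite !P0 mulr0 add0r.
have PE := deriv_eq0_const charU P'0.
have := P0 1; rewrite PE (diffopEw (N := 1)) ?size_polyC_leq1 //.
by rewrite big_ord1 coefC mulr1 => ->.
Qed.

End LinearOperators.

Section FixedVector.
Context (K U : diffFieldType) (iota : {rmorphism K -> U}) (n : nat).
Context (charU : [pchar U] =i pred0).

Local Notation Ga_coordinate := (@coordinate_function K U iota (Ga U n)).

Lemma ffunMnE (a : Ga U n) c i : (a *+ c : {ffun 'I_n -> U}) i = a i *+ c.
Proof. by elim: c => [|c IH]; rewrite ?mulr0n ?ffunE // !mulrS ffunE IH. Qed.

(** Along the multiples of a, the function f is the polynomial q(a), whose linear
    coefficient is a linear differential operator in a with coefficients in K. *)
Definition line_expansion (f : Ga U n -> U) (q : Ga U n -> {poly U})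
    (k : 'I_n -> {poly K}) :=
  forall a, (forall c : nat, f (a *+ c) = (q a).[c%:R])
    /\ (q a)`_1 = \sum_i diffop (map_poly iota (k i)) (a i).

(** The constant term of q(a) is an element of K independent of a; the induction
    needs this to keep the linear coefficient of a product linear in a. *)
Lemma Ga_coordinate_line_expansion f :
  Ga_coordinate f -> exists q k, line_expansion f q k.
Proof.
move=> cf; suff [q [k0 [k H]]] : exists q (k0 : K) k,
    line_expansion f q k /\ forall a, (q a)`_0 = iota k0 by exists q, k; case: H.
elim/coordinate_ind: cf => {f} [f g fg|c|i j|f g|f g].
- move=> [q [k0 [k [H H0]]]]; exists q, k0, k; split=> // a; have [qE q1] := H a.
  by split=> // c; rewrite -fg.
- exists (fun=> (iota c)%:P), c, (fun=> 0); split=> a; last by rewrite coefC.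
  split=> [?|]; first by rewrite hornerC.
  by rewrite coefC /= big1 // => l _; rewrite map_poly0 diffop0p.
- exists (fun a : Ga U n => iter j der (a i) *: 'X), 0.
  exists (fun l : 'I_n => if l == i then 'X^j else 0).
  split=> a; last by rewrite coefZ coefX mulr0 rmorph0.
  split=> [c|].
    rewrite /= ffunMnE -[a i *+ c]mulr_natl iter_derMconst ?der_nat //.
    by rewrite hornerZ hornerX mulrC.
  rewrite coefZ coefX mulr1 (bigD1 i) //= eqxx map_polyXn diffop_Xn.
  by rewrite big1 ?addr0 // => l /negPf->; rewrite map_poly0 diffop0p.
- move=> [q [k0 [k [H H0]]]] [q' [k0' [k' [H' H0']]]].
  exists (fun a => q a + q' a), (k0 + k0'), (fun i => k i + k' i).
  split=> a; last by rewrite coefD H0 H0' rmorphD.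
  have [qE q1] := H a; have [q'E q'1] := H' a.
  split=> [c|]; first by rewrite hornerD qE q'E.
  rewrite coefD q1 q'1 -big_split; apply: eq_bigr => i _.
  by rewrite rmorphD /= diffopD.
- move=> [q [k0 [k [H H0]]]] [q' [k0' [k' [H' H0']]]].
  exists (fun a => q a * q' a), (k0 * k0'), (fun i => k0 *: k' i + k0' *: k i).
  split=> a; last by rewrite coefM big_ord1 H0 H0' rmorphM.
  have [qE q1] := H a; have [q'E q'1] := H' a.
  split=> [c|]; first by rewrite hornerM qE q'E.
  rewrite coefM !big_ord_recl big_ord0 /= addr0 H0 H0' q1 q'1.
  rewrite mulr_sumr mulr_suml -big_split; apply: eq_bigr => i _.
  by rewrite rmorphD /= !map_polyZ diffopD !diffopZ (mulrC (iota k0')).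
Qed.

Context (m : nat) (alpha : Ga U n -> 'M[U]_m) (alpha_rep : diff_rep iota alpha).

Lemma Ga_repD a b : alpha (a + b) = alpha a *m alpha b.
Proof. by case: alpha_rep => _ aM _; exact: aM. Qed.

Lemma Ga_rep0 : alpha 0 = 1%:M.
Proof.
have [aU _ _] := alpha_rep; have := Ga_repD 0 0.
rewrite addr0 => /(congr1 (mulmx (invmx (alpha 0)))).
by rewrite mulmxA mulVmx ?mul1mx // aU.
Qed.

Lemma Ga_rep_comm a b : alpha a *m alpha b = alpha b *m alpha a.
Proof. by rewrite -!Ga_repD addrC. Qed.

Lemma Ga_rep_line_expansion :
  exists (Q : 'I_m -> 'I_m -> Ga U n -> {poly U})
         (k : 'I_m -> 'I_m -> 'I_n -> {poly K}),
    forall i j, line_expansion (fun a => alpha a i j) (Q i j) (k i j).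
Proof.
have [_ _ ca] := alpha_rep.
have /fin_all_exists[Q HQ] i : exists Q, forall j, exists k,
    line_expansion (fun a => alpha a i j) (Q j) k.
  exact: (fin_all_exists (fun j => Ga_coordinate_line_expansion (ca i j))).
have /fin_all_exists[k Hk] i := fin_all_exists (HQ i).
by exists Q, k.
Qed.

Section Lines.
Context (Q : 'I_m -> 'I_m -> Ga U n -> {poly U}).
Context (k : 'I_m -> 'I_m -> 'I_n -> {poly K}).
Hypothesis QP : forall i j, line_expansion (fun a => alpha a i j) (Q i j) (k i j).

(** The j-th coordinate of u alpha(c a), as a polynomial in c. *)
Definition orbit_poly (u : 'rV[U]_m) a j : {poly U} := \sum_l u 0 l *: Q l j a.

Lemma orbit_polyE u a j (c : nat) :
  (orbit_poly u a j).[c%:R] = (u *m alpha (a *+ c)) 0 j.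
Proof.
rewrite /orbit_poly horner_sum mxE; apply: eq_bigr => l _.
by rewrite hornerZ; have [-> _] := QP l j a.
Qed.

(** The identity u alpha((c + c') a) = u alpha(c' a) alpha(c a), as polynomials
    in c'. *)
Lemma orbit_poly_shift u a j (c : nat) :
  orbit_poly u a j \Po ('X + c%:R%:P)
    = \sum_l alpha (a *+ c) l j *: orbit_poly u a l.
Proof.
apply: (poly_nat_inj charU) => c'; rewrite horner_comp !hornerE -natrD.
rewrite orbit_polyE mulrnDr Ga_repD mulmxA mxE horner_sum.
by apply: eq_bigr => l _; rewrite hornerZ orbit_polyE mulrC.
Qed.

(** Let D be the degree of the polynomial vector u alpha(c a). Its coefficient of
    c^D lies in V, since all values do, and is not changed by the substitution
    of c + 1 for c, that is, by alpha(a). *)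
Lemma stable_fixed_vector (V : 'M[U]_m) a :
  V != 0 -> (forall b, stablemx V (alpha b)) ->
  exists v : 'rV[U]_m, [/\ v != 0, (v <= V)%MS & v *m alpha a = v].
Proof.
move=> V0 Vst; have /row_subPn[i] : ~~ (V <= (0 : 'M[U]_m))%MS by rewrite submx0.
rewrite submx0; set u := row i V => u0.
have uV c : (u *m alpha (a *+ c) <= V)%MS.
  by apply: submx_trans (Vst _); apply: submxMr; exact: row_sub.
(* The predecessor turns the largest size into the degree. *)
pose D := (\max_j size (orbit_poly u a j)).-1.
have sizeD j : (size (orbit_poly u a j) <= D.+1)%N.
  by apply: leq_trans (leqSpred _); exact: leq_bigmax.
exists (\row_j (orbit_poly u a j)`_D); split.
- have [j0 uj0] : exists j, u 0 j != 0 by apply/rV0Pn.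
  have [j jmax] : {j | \max_j size (orbit_poly u a j) = size (orbit_poly u a j)}.
    apply: eq_bigmax; rewrite card_ord.
    exact: leq_ltn_trans (leq0n j0) (ltn_ord j0).
  have pj0 : orbit_poly u a j != 0.
    rewrite -size_poly_gt0 -jmax.
    rewrite (@leq_trans (size (orbit_poly u a j0))) ?leq_bigmax //.
    rewrite size_poly_gt0; apply: contraNneq uj0 => p0.
    by have := orbit_polyE u a j0 0; rewrite p0 horner0 mulr0n Ga_rep0 mulmx1 => <-.
  apply/rV0Pn; exists j; rewrite mxE /D jmax.
  by rewrite -lead_coefE lead_coef_eq0.
- rewrite submxE; apply/eqP/rowP => l; rewrite !mxE.
  have : \sum_j cokermx V j l *: orbit_poly u a j = 0.
    apply: (poly_nat_eq0 charU) => c; have := uV c.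
    rewrite submxE => /eqP/rowP/(_ l); rewrite !mxE horner_sum => E.
    rewrite -[RHS]E; apply: eq_bigr => j _.
    by rewrite hornerZ orbit_polyE mulrC.
  move=> /polyP/(_ D); rewrite coef0 coef_sum => E; rewrite -[RHS]E.
  by apply: eq_bigr => j _; rewrite coefZ mxE mulrC.
- apply/rowP => j; rewrite !mxE.
  rewrite -(coef_comp_translate 1%:R (sizeD j)).
  rewrite (orbit_poly_shift u a j 1) coef_sum.
  by apply: eq_bigr => l _; rewrite coefZ mxE mulr1n mulrC.
Qed.

(** If alpha(a) moves a vector of V, the vectors of V that alpha(a) fixes form a
    smaller subspace, which is nonzero and, by commutativity, stable. *)
Lemma common_fixed_vector (V : 'M[U]_m) :
  V != 0 -> (forall b, stablemx V (alpha b)) ->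
  exists v : 'rV[U]_m, [/\ v != 0, (v <= V)%MS & forall a, v *m alpha a = v].
Proof.
have [N] := ubnP (\rank V); elim: N V => // N IH V rankV V0 Vst.
have [Vfix|] := classic (forall a, V *m alpha a = V).
  have /row_subPn[i] : ~~ (V <= (0 : 'M[U]_m))%MS by rewrite submx0.
  rewrite submx0 => u0; exists (row i V); split=> // [|a]; first exact: row_sub.
  by rewrite -row_mul Vfix.
move=> /not_all_ex_not[a Va].
pose V' := (V :&: kermx (alpha a - 1%:M))%MS.
have V'V : (V' <= V)%MS by exact: capmxSl.
have [v [v0 vV va]] := stable_fixed_vector a V0 Vst.
have vV' : (v <= V')%MS.
  by rewrite sub_capmx vV sub_kermx mulmxBr mulmx1 va subrr eqxx.
have rank' : (\rank V' < \rank V)%N.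
  rewrite ltn_neqAle mxrankS // andbT; apply/negP.
  rewrite (mxrank_leqif_sup V'V).2 sub_capmx.
  case/andP=> _ /sub_kermxP/eqP; rewrite mulmxBr mulmx1 subr_eq0 => /eqP.
  exact: Va.
have V'0 : V' != 0 by apply: contraNneq v0 => V'0; rewrite -submx0 -V'0.
have [b|w [w0 wV' wfix]] := IH V' (leq_trans rank' rankV) V'0.
  rewrite sub_capmx (submx_trans _ (Vst b)) ?submxMr //=.
  rewrite sub_kermx -mulmxA mulmxBr mulmx1 Ga_rep_comm.
  rewrite -[X in _ - X]mul1mx -mulmxBl mulmxA.
  by have /sub_kermxP-> := capmxSr V (kermx (alpha a - 1%:M)); rewrite mul0mx.
by exists w; split=> //; exact: submx_trans wV' V'V.
Qed.

(** The orbit of a fixed vector is constant, so its linear coefficient, a linear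
    differential operator in a, vanishes identically and has zero coefficients. *)
Lemma killed_by_linear_part (v : 'rV[U]_m) (t : U) : der t = 1 ->
  (forall a, v *m alpha a = v) ->
  forall j i s, \sum_l v 0 l * iota (k l j i)`_s = 0.
Proof.
move=> der_t vfix j i s.
have lin0 a : \sum_l v 0 l * (Q l j a)`_1 = 0.
  have : orbit_poly v a j = (v 0 j)%:P.
    by apply: (poly_nat_inj charU) => c; rewrite orbit_polyE vfix hornerC.
  move=> /polyP/(_ 1); rewrite coefC coef_sum => E; rewrite -[RHS]E.
  by apply: eq_bigr => l _; rewrite coefZ.
have : \sum_l v 0 l *: map_poly iota (k l j i) = 0.
  apply: (diffop_eq0 der_t charU) => y.
  pose a : Ga U n := [ffun i' => if i' == i then y else 0].
  rewrite diffop_sum -[RHS](lin0 a); apply: eq_bigr => l _.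
  have [_ ->] := QP l j a; rewrite diffopZ (bigD1 i) //= /a ffunE eqxx.
  by rewrite big1 ?addr0 // => i' /negPf i'i; rewrite ffunE i'i diffop_0.
move=> /polyP/(_ s); rewrite coef0 coef_sum => E; rewrite -[RHS]E.
by apply: eq_bigr => l _; rewrite coefZ coef_map.
Qed.

(** The conditions on w form a finite linear system over K, whose rank does not
    change over U. *)
Lemma killed_vector_descent (v : 'rV[U]_m) : v != 0 ->
  (forall j i s, \sum_l v 0 l * iota (k l j i)`_s = 0) ->
  exists2 w : 'rV[K]_m, w != 0 & forall j i s, \sum_l w 0 l * (k l j i)`_s = 0.
Proof.
move=> v0 vk; pose h := \max_l \max_j \max_i size (k l j i).
(* The columns of N list all coefficients of all the operators; h bounds their
   number in each operator. *)
pose N : 'M[K]_(m, #|{: 'I_m * 'I_n * 'I_h}|) :=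
  \matrix_(l < m, p < #|{: 'I_m * 'I_n * 'I_h}|)
     let: (j, i, s) := enum_val p in (k l j i)`_(s : 'I_h).
have : ~~ (kermx (map_mx iota N) <= (0 : 'M[U]_m))%MS.
  apply: contra v0 => ker0; rewrite -submx0; apply: submx_trans ker0.
  apply/sub_kermxP/rowP => p; rewrite !mxE; case E: (enum_val p) => [[j i] s].
  by rewrite -[RHS](vk j i s); apply: eq_bigr => l _; rewrite !mxE E.
rewrite submx0 -map_kermx map_mx_eq0 -submx0 => /row_subPn[i].
rewrite submx0 => w0; exists (row i (kermx N)) => // j i' s.
have [sh|hs] := ltnP s h; last first.
  apply: big1 => l _; rewrite nth_default ?mulr0 //; apply: leq_trans hs.
  by do 3!(apply: leq_trans (leq_bigmax _); rewrite //).
have /rowP/(_ (enum_rank (j, i', Ordinal sh))) : row i (kermx N) *m N = 0.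
  by apply/sub_kermxP; exact: row_sub.
rewrite !mxE => E; rewrite -[RHS]E; apply: eq_bigr => l _.
by rewrite !mxE enum_rankK.
Qed.

(** The orbit u(c) satisfies u(c + c') = u(c') alpha(c a). Differentiating at
    c' = 0 gives u'(c) = u'(0) alpha(c a) = 0, so that u(1) = u(0). *)
Lemma fixed_of_linear_part (w : 'rV[K]_m) :
  (forall j i s, \sum_l w 0 l * (k l j i)`_s = 0) ->
  forall a, map_mx iota w *m alpha a = map_mx iota w.
Proof.
move=> wk a; set v := map_mx iota w.
have lin0 j : (orbit_poly v a j)`_1 = 0.
  transitivity (\sum_i diffop (\sum_l v 0 l *: map_poly iota (k l j i)) (a i)).
    under [RHS]eq_bigr do rewrite diffop_sum.
    rewrite exchange_big coef_sum; apply: eq_bigr => l _.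
    rewrite coefZ; have [_ ->] := QP l j a; rewrite mulr_sumr.
    by apply: eq_bigr => i _; rewrite diffopZ.
  apply: big1 => i _; rewrite [X in diffop X _](_ : _ = 0) ?diffop0p //.
  apply/polyP => s.
  rewrite coef0 coef_sum -[RHS](rmorph0 iota) -(wk j i s) rmorph_sum.
  by apply: eq_bigr => l _; rewrite coefZ coef_map mxE rmorphM.
have const j : orbit_poly v a j = ((orbit_poly v a j)`_0)%:P.
  apply: (deriv_eq0_const charU); apply: (poly_nat_eq0 charU) => c.
  have /(congr1 (fun p => p^`().[0])) := orbit_poly_shift v a j c.
  rewrite deriv_comp derivD derivX derivC addr0 mulr1 horner_comp !hornerE => ->.
  rewrite linear_sum horner_sum; apply: big1 => l _.
  by rewrite /= derivZ hornerZ horner_coef0 coef_deriv lin0 mul0rn mulr0.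
apply/rowP => j; have := orbit_polyE v a j 1; have := orbit_polyE v a j 0.
by rewrite const !hornerC mulr0n mulr1n Ga_rep0 mulmx1 => -> ->.
Qed.

End Lines.

(** The linear coefficients carry a common fixed vector from U down to K, as their
    matrices have entries in K. *)
Theorem Ga_rep_fixed_vector (t : U) : der t = 1 -> (0 < m)%N ->
  exists2 w : 'rV[K]_m, w != 0 &
    forall a, map_mx iota w *m alpha a = map_mx iota w.
Proof.
move=> der_t m_gt0; have [Q [k QP]] := Ga_rep_line_expansion.
have [||v [v0 _ vfix]] := common_fixed_vector QP (V := 1%:M).
- by rewrite -mxrank_eq0 mxrank1 -lt0n.
- by move=> b; exact: submx1.
have [w w0 wk] := killed_vector_descent v0 (killed_by_linear_part QP der_t vfix).
exists w => //; exact: (fixed_of_linear_part QP wk).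
Qed.

End FixedVector.

(** * Equivalence and splittings of representations *)

Section Equivalence.
Context (K U : diffFieldType) (iota : {rmorphism K -> U}) (G : dgroup U).
Local Notation "A ^i" := (map_mx iota A) (at level 2, format "A ^i").

(** Two mutually inverse rectangular matrices encode an equivalence without a
    cast between the dimensions, which are forced to agree by rank. *)
Lemma rep_equivP r1 r2 (beta1 : G -> 'M[U]_r1) (beta2 : G -> 'M[U]_r2) :
  rep_equiv iota beta1 beta2 <->
  exists (X : 'M[K]_(r2, r1)) (Y : 'M[K]_(r1, r2)),
    [/\ X *m Y = 1%:M, Y *m X = 1%:M
      & forall x, gpoint x -> beta2 x = X^i *m beta1 x *m Y^i].
Proof.
split=> [[e [P [uP PE]]]|[X [Y [XY YX XYE]]]].
  case: r2 / e beta2 P uP PE => beta2 P uP PE; exists (invmx P), P.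
  rewrite mulmxV ?mulVmx //; split=> // x x0.
  by rewrite PE // castmx_id map_invmx.
have e : r1 = r2.
  apply/eqP; rewrite eqn_leq -{1}(mxrank1 K r1) -YX -{3}(mxrank1 K r2) -XY.
  by rewrite (leq_trans (mxrankM_maxr _ _)) ?rank_leq_row //=
             (leq_trans (mxrankM_maxr _ _)) ?rank_leq_row.
case: r2 / e beta2 X Y XY YX XYE => beta2 X Y XY YX XYE.
have [uX uY] := mulmx1_unit XY; exists erefl, Y; split=> // x x0.
rewrite castmx_id -map_invmx (_ : invmx Y = X) ?XYE //.
by rewrite -[LHS]mul1mx -XY mulmxK.
Qed.

End Equivalence.

Section Splittings.
Context (K U : diffFieldType) (iota : {rmorphism K -> U}) (n : nat).
Local Notation "A ^i" := (map_mx iota A) (at level 2, format "A ^i").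
Local Notation weight := {ffun 'I_n -> int}.

(** R d and C d are the projection to and the inclusion of the d-th summand. *)
Definition splitting r (beta : Gm U n -> 'M[U]_r) (s : seq weight)
    (rd : weight -> nat) (alpha : forall d, Ga U n -> 'M[U]_(rd d))
    (C : forall d, 'M[K]_(r, rd d)) (R : forall d, 'M[K]_(rd d, r)) :=
  [/\ forall d, R d *m C d = 1%:M, forall d e, d != e -> R d *m C e = 0,
      \sum_(d <- s) C d *m R d = 1%:M
    & forall x, gpoint x ->
        beta x = \sum_(d <- s) (C d)^i *m twist d (alpha d) x *m (R d)^i].

Lemma mxblock_mul_eq1 (k r : nat) (p : 'I_k -> nat)
    (C : forall i, 'M[K]_(r, p i)) (R : forall i, 'M[K]_(p i, r)) :
  \mxcol_i R i *m \mxrow_i C i = 1%:M <->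
  (forall i, R i *m C i = 1%:M) /\ (forall i j, i != j -> R i *m C j = 0).
Proof.
rewrite mul_mxcol_mxrow -mxdiagZ /mxdiag -eq_mxblockP.
split=> [E|[E1 E0] i j].
  split=> [i|i j /negPf ij]; rewrite E ?ij //.
  by rewrite eqxx conform_mx_id.
by have [<-|/E0 //] := eqVneq i j; rewrite conform_mx_id E1.
Qed.

Lemma big_seq_ord (V : nmodType) (s : seq weight) (F : weight -> V) :
  \sum_(d <- s) F d = \sum_(i < size s) F s`_i.
Proof. by rewrite (big_nth 0) big_mkord. Qed.

(** The block of X at the position of a weight d of s has a size that is only
    provably equal to rd d; conform_mx performs the cast. *)
Lemma mxrow_family r (s : seq weight) (rd : weight -> nat)
    (X : 'M[K]_(r, \sum_(i < size s) rd (s`_i)%R)) : uniq s ->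
  exists C : forall d, 'M[K]_(r, rd d), X = \mxrow_(i < size s) C s`_i.
Proof.
move=> uniq_s.
exists (fun d => if insub (index d s) is Some i
                 then conform_mx 0 (submxrow X i) else 0).
rewrite -[LHS]submxrowK; apply: eq_mxrow => i.
by rewrite index_uniq // valK conform_mx_id.
Qed.

Lemma mxcol_family r (s : seq weight) (rd : weight -> nat)
    (Y : 'M[K]_(\sum_(i < size s) rd (s`_i)%R, r)) : uniq s ->
  exists R : forall d, 'M[K]_(rd d, r), Y = \mxcol_(i < size s) R s`_i.
Proof.
move=> uniq_s.
exists (fun d => if insub (index d s) is Some i
                 then conform_mx 0 (submxcol Y i) else 0).
rewrite -[LHS]submxcolK; apply: eq_mxcol => i.
by rewrite index_uniq // valK conform_mx_id.
Qed.

Lemma map_mxrow r k (p : 'I_k -> nat) (C : forall i, 'M[K]_(r, p i)) :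
  (\mxrow_i C i)^i = \mxrow_i (C i)^i.
Proof. by apply/matrixP => i j; rewrite !mxE. Qed.

Lemma map_mxcol r k (p : 'I_k -> nat) (R : forall i, 'M[K]_(p i, r)) :
  (\mxcol_i R i)^i = \mxcol_i (R i)^i.
Proof. by apply/matrixP => i j; rewrite !mxE. Qed.

Lemma mx_dim0 (F : nzRingType) m1 m2 (A B : 'M[F]_(m1, m2)) :
  m1 = 0%N \/ m2 = 0%N -> A = B.
Proof.
case=> m0; move: A B; rewrite m0 => A B.
  by rewrite [A]flatmx0 [B]flatmx0.
by rewrite [A]thinmx0 [B]thinmx0.
Qed.

Lemma decompositionP r (beta : Gm U n -> 'M[U]_r) s rd
    (alpha : forall d, Ga U n -> 'M[U]_(rd d)) :
  decomposition iota beta s alpha <->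
  [/\ uniq s, forall d, d \notin s -> rd d = 0%N, forall d, diff_rep iota (alpha d)
    & exists C R, splitting beta s alpha C R].
Proof.
have sumE C R x : (\mxrow_(i < size s) C s`_i)^i
      *m direct_sum s (fun d => twist d (alpha d)) x *m (\mxcol_(i < size s) R s`_i)^i
    = \sum_(d <- s) (C d)^i *m twist d (alpha d) x *m (R d)^i.
  rewrite map_mxrow map_mxcol /direct_sum mul_mxrow_mxdiag mul_mxrow_mxcol.
  by rewrite big_seq_ord.
split=> [[uniq_s rd0 arep /rep_equivP[X [Y [XY YX bE]]]]|].
  split=> //.
  have [C CE] := mxrow_family X uniq_s; have [R RE] := mxcol_family Y uniq_s.
  move: XY YX bE; rewrite {}CE {}RE mul_mxrow_mxcol => XY.
  move=> /mxblock_mul_eq1[YX1 YX0] bE; exists C, R; split=> [d|d e de||x x0].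
  - have [/(nthP 0)[i i_s <-]|/rd0 d0] := boolP (d \in s).
      exact: (YX1 (Ordinal i_s)).
    by apply: mx_dim0; left.
  - have [/(nthP 0)[i i_s dE]|/rd0 d0] := boolP (d \in s); last first.
      by apply: mx_dim0; left.
    have [/(nthP 0)[j j_s eE]|/rd0 e0] := boolP (e \in s); last first.
      by apply: mx_dim0; right.
    move: de; rewrite -dE -eE => ij; apply: (YX0 (Ordinal i_s) (Ordinal j_s)).
    by apply: contraNneq ij => -[->].
  - by rewrite big_seq_ord.
  - by rewrite bE // sumE.
move=> [uniq_s rd0 arep [C [R [RC1 RC0 CR bE]]]]; split=> //; apply/rep_equivP.
exists (\mxrow_i C s`_i), (\mxcol_i R s`_i); split=> [||x x0].
- by rewrite mul_mxrow_mxcol -CR big_seq_ord.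
- apply/mxblock_mul_eq1; split=> [i|i j ij]; first exact: RC1.
  by apply: RC0; apply: contraNneq ij => /eqP; rewrite nth_uniq.
- by rewrite sumE bE.
Qed.

End Splittings.

(** * Components of a representation of the torus *)

Lemma seq_choice (I : eqType) (T : Type) (t0 : T) (s : seq I) (P : I -> T -> Prop) :
  (forall i, i \in s -> exists t, P i t) ->
  exists f : I -> T, forall i, i \in s -> P i (f i).
Proof.
elim: s => [|i s IH] exP; first by exists (fun=> t0).
have [|f fP] := IH; first by move=> j js; apply: exP; rewrite inE js orbT.
have [t tP] := exP i (mem_head _ _).
exists (fun j => if j == i then t else f j) => j.
by rewrite inE; case: eqP => [->|_] //= /fP.
Qed.

Section CoordinateMatrices.
Context (K U : diffFieldType) (iota : {rmorphism K -> U}) (G : dgroup U).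
Local Notation "A ^i" := (map_mx iota A) (at level 2, format "A ^i").

Lemma coordinate_mulmx m1 m2 m3 m4 (X : 'M[K]_(m1, m2)) (Y : 'M[K]_(m3, m4))
    (M : G -> 'M[U]_(m2, m3)) :
  (forall i j, coordinate_function iota (fun x => M x i j)) ->
  forall i j, coordinate_function iota (fun x => (X^i *m M x *m Y^i) i j).
Proof.
move=> cM i j.
apply: (@coordinate_ext _ _ iota G
  (fun x => \sum_k (\sum_l iota (X i l) * M x l k) * iota (Y k j))).
  move=> x _; rewrite mxE; apply: eq_bigr => k _; rewrite !mxE; congr (_ * _).
  by apply: eq_bigr => l _; rewrite !mxE.
apply: coordinate_sum => k; apply: coordinateM; last exact: coordinate_const.
apply: coordinate_sum => l; apply: coordinateM => //; exact: coordinate_const.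
Qed.

End CoordinateMatrices.

Section TorusRepresentations.
Context (K U : diffFieldType) (iota : {rmorphism K -> U}) (n : nat).
Local Notation "A ^i" := (map_mx iota A) (at level 2, format "A ^i").
Local Notation weight := {ffun 'I_n -> int}.
Local Notation point := (@gpoint U (Gm U n)).
Context (charU : [pchar U] =i pred0) (iota_diff : diff_morphism iota).
Context (U_closed : diff_closed U).

(** alpha(-a) is inverse to alpha(a). *)
Lemma Ga_rep_intro m (A : Ga U n -> 'M[U]_m) :
  A 0 = 1%:M -> (forall a b, A (a + b) = A a *m A b) ->
  (forall i j, coordinate_function iota (fun a => A a i j)) -> diff_rep iota A.
Proof.
move=> A0 AD cA; split=> // [a _|a b _ _]; last exact: AD.
have := mulmx1_unit (A := A a) (B := A (- a)).
by rewrite -AD addrN A0 => /(_ erefl)[].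
Qed.

(** A rank factorization C d R d of the idempotent B d 0 provides the inclusion
    and the projection of its image. *)
Lemma splitting_exists r (beta : Gm U n -> 'M[U]_r) : diff_rep iota beta ->
  exists (s : seq weight) (rd : weight -> nat)
         (alpha : forall d, Ga U n -> 'M[U]_(rd d)),
    [/\ uniq s, forall d, d \notin s -> rd d = 0%N, forall d, diff_rep iota (alpha d)
      & exists C R, splitting iota beta s alpha C R].
Proof.
move=> beta_rep; have [_ _ cb] := beta_rep.
have [s [B Bexp]] := matrix_coordinate_expansion iota_diff cb.
have BM := expansion_mul charU U_closed beta_rep Bexp.
have B1 := expansion_sum0 beta_rep Bexp.
have [uniq_s cB B0 bE] := Bexp.
have [E0 E0P] : exists E0 : weight -> 'M[K]_r, forall d, d \in s -> B d 0 = (E0 d)^i.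
  apply: (seq_choice (0 : 'M[K]_r) (P := fun d E => B d 0 = E^i)) => d _.
  have /fin_all_exists[E1 E1P] i : exists E1, forall j, B d 0 i j = iota (E1 j).
    exact: (fin_all_exists (fun j => Ga_coordinate_at0 (cB d i j))).
  by exists (\matrix_(i, j) E1 i j); apply/matrixP => i j; rewrite !mxE.
pose E d := if d \in s then E0 d else 0.
have EP d : B d 0 = (E d)^i.
  by rewrite /E; case: ifPn => [/E0P //|/B0 ->]; rewrite map_mx0.
have EE d e : E d *m E e = if d == e then E d else 0.
  apply: (@map_mx_inj _ _ iota); rewrite map_mxM -!EP BM addr0.
  by case: ifP => _; rewrite ?EP ?map_mx0.
pose C d : 'M[K]_(r, \rank (E d)) := col_base (E d).
pose R d : 'M[K]_(\rank (E d), r) := row_base (E d).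
have CR d : C d *m R d = E d by exact: mulmx_base.
have CK d p : injective (mulmx (C d) : 'M_(_, p) -> _).
  exact: row_full_inj (col_base_full _).
have RK d p : injective (mulmxr (R d) : 'M_(p, _) -> _).
  exact: row_free_inj (row_base_free _).
have RC d e : R d *m C e = if d == e then R d *m C e else 0.
  case: eqVneq => // de; apply: (CK d); apply: (RK e).
  by rewrite /= mulmxA CR -mulmxA CR EE (negPf de) mulmx0 mul0mx.
have RC1 d : R d *m C d = 1%:M.
  apply: (CK d); apply: (RK d).
  by rewrite /= mulmxA CR -mulmxA CR EE eqxx mulmx1 CR.
pose alpha d a := (R d)^i *m B d a *m (C d)^i.
have alphaE d a : (C d)^i *m alpha d a *m (R d)^i = B d a.
  rewrite /alpha !mulmxA -map_mxM CR -!mulmxA -map_mxM CR -EP.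
  by rewrite BM eqxx BM eqxx add0r addr0.
exists s, (fun d => \rank (E d)), alpha; split=> // [d /negPf ds|d|].
- by rewrite /E ds mxrank0.
- apply: Ga_rep_intro => [|a b|].
  + rewrite /alpha EP -!map_mxM (_ : R d *m E d = R d) ?RC1 ?map_mx1 //.
    by apply: (CK d); rewrite mulmxA CR EE eqxx.
  + transitivity ((R d)^i *m (B d a *m B d 0 *m B d b) *m (C d)^i).
      by rewrite BM eqxx BM eqxx addr0.
    rewrite /alpha -!mulmxA [(C d)^i *m (_ *m (_ *m _))]mulmxA -map_mxM CR -EP.
    by rewrite !mulmxA.
  + exact: coordinate_mulmx.
exists C, R; split=> // [d e de||x x0].
- by rewrite RC (negPf de).
- apply: (@map_mx_inj _ _ iota).
  rewrite map_mx1 -B1 raddf_sum; apply: eq_bigr => d _.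
  by rewrite /= CR EP.
- rewrite bE //; apply: eq_bigr => d _; rewrite /twist.
  by rewrite -scalemxAr -scalemxAl alphaE.
Qed.

Section Blocks.
Context r (beta : Gm U n -> 'M[U]_r) (s : seq weight) (rd : weight -> nat).
Context (alpha : forall d, Ga U n -> 'M[U]_(rd d)).
Context (C : forall d, 'M[K]_(r, rd d)) (R : forall d, 'M[K]_(rd d, r)).
Hypothesis uniq_s : uniq s.
Hypothesis rd0 : forall d, d \notin s -> rd d = 0%N.
Hypothesis alpha_rep : forall d, diff_rep iota (alpha d).
Hypothesis beta_split : splitting iota beta s alpha C R.

(** The contribution of the d-th summand to beta, without the factor chi^d. *)
Definition block d a := (C d)^i *m alpha d a *m (R d)^i.

Lemma block_eq0 d a : d \notin s -> block d a = 0.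
Proof.
move=> /rd0 d0; rewrite /block (_ : (C d)^i = 0) ?mul0mx //.
by apply: mx_dim0; right.
Qed.

Lemma block_mul d e a b :
  block d a *m block e b = if d == e then block d (a + b) else 0.
Proof.
have [RC1 RC0 _ _] := beta_split; rewrite /block !mulmxA.
rewrite -[_ *m (R d)^i *m (C e)^i]mulmxA -map_mxM.
case: eqVneq => [<-|/RC0 ->]; last by rewrite map_mx0 mulmx0 !mul0mx.
rewrite RC1 map_mx1 mulmx1 (Ga_repD (alpha_rep d)).
by rewrite !mulmxA.
Qed.

Lemma block0 d : block d 0 = (C d *m R d)^i.
Proof. by rewrite /block (Ga_rep0 (alpha_rep d)) mulmx1 map_mxM. Qed.

Lemma sum_blocks x :
  point x -> beta x = \sum_(d <- s) chi d x *: block d (logder x).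
Proof.
have [_ _ _ bE] := beta_split; move=> /bE->; apply: eq_bigr => d _.
by rewrite /twist -scalemxAr -scalemxAl.
Qed.

Lemma row_beta d x : point x ->
  (R d)^i *m beta x = chi d x *: (alpha d (logder x) *m (R d)^i).
Proof.
have [RC1 RC0 _ bE] := beta_split.
have [ds x0|/rd0 d0 _] := boolP (d \in s); last by apply: mx_dim0; left.
rewrite bE // mulmx_sumr (bigD1_seq d) //= !mulmxA -map_mxM RC1 map_mx1 mul1mx.
rewrite /twist -scalemxAl big1 ?addr0 // => e /negPf ed.
by rewrite !mulmxA -map_mxM RC0 1?eq_sym ?ed // map_mx0 !mul0mx.
Qed.

Lemma beta_block d a x : point x ->
  beta x *m block d a = chi d x *: block d (logder x + a).
Proof.
move=> x0; have [ds|ds] := boolP (d \in s); last first.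
  by rewrite !block_eq0 ?mulmx0 ?scaler0.
rewrite sum_blocks // mulmx_suml (bigD1_seq d) //= -scalemxAl block_mul eqxx.
rewrite big1 ?addr0 // => e /negPf ed.
by rewrite -scalemxAl block_mul ed scaler0.
Qed.

(** The transpose turns the column space of the idempotent C d R d, on which beta
    acts, into a row space. *)
Definition component d : 'M[K]_r := (C d *m R d)^T.

Lemma component_map d : (component d)^i = (block d 0)^T.
Proof. by rewrite /component -map_trmx block0. Qed.

Lemma beta_component d p (V : 'M[K]_(p, r)) x : (V <= component d)%MS -> point x ->
  V^i *m (beta x)^T = chi d x *: (V^i *m (block d (logder x))^T).
Proof.
move=> /submxP[V' ->] x0; rewrite map_mxM component_map -!mulmxA -!trmx_mul.
by rewrite beta_block // block_mul eqxx !addr0 linearZ /= -scalemxAr.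
Qed.

Lemma block_sub_component d p (V : 'M[U]_(p, r)) a :
  (V *m (block d a)^T <= (component d)^i)%MS.
Proof.
apply: submx_trans (submxMl V _) _; rewrite component_map.
have -> : block d a = block d 0 *m block d a by rewrite block_mul eqxx add0r.
by rewrite trmx_mul submxMl.
Qed.

Lemma component_id d p (V : 'M[K]_(p, r)) : (V <= component d)%MS ->
  V^i *m (block d 0)^T = V^i.
Proof.
move=> /submxP[V' ->]; rewrite map_mxM component_map -mulmxA -trmx_mul.
by rewrite block_mul eqxx addr0.
Qed.

Lemma component_subrep d : subrep iota beta (component d).
Proof.
move=> x x0; rewrite (beta_component (submx_refl _) x0); apply: scalemx_sub.
exact: block_sub_component.
Qed.

(** lambda is onto, and on the d-th component block d (lambda x) is beta x up to
    the nonzero scalar chi^d(x). *)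
Lemma component_stable_block d p (V : 'M[K]_(p, r)) a : (V <= component d)%MS ->
  (forall x, point x -> (V^i *m (beta x)^T <= V^i)%MS) ->
  (V^i *m (block d a)^T <= V^i)%MS.
Proof.
move=> Vd Vst; have [x x0 <-] := logder_surj a U_closed.
have := Vst x x0; rewrite (beta_component Vd x0).
by rewrite (eqmx_scale _ (chi_neq0 d x0)).
Qed.

(** B is independent modulo W1, so its rows can be read off from the classes
    modulo W1. *)
Lemma subquotient_projection (W1 W2 : 'M[K]_r) m (B : 'M[K]_(m, r)) :
  (W1 + B == W2)%MS -> \rank W2 = (\rank W1 + m)%N ->
  exists T : 'M[K]_(r, m), W1 *m T = 0 /\ B *m T = 1%:M.
Proof.
move=> /eqmxP W12 rank2; exists (cokermx W1 *m pinvmx (B *m cokermx W1)).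
split; first by rewrite mulmxA mulmx_coker mul0mx.
rewrite mulmxA mulmxVp //.
rewrite /row_free eqn_leq rank_leq_row /= -(leq_add2l (\rank W1)) -rank2.
rewrite -(mxrank_mul_ker W2 (cokermx W1)) addnC leq_add ?mxrankS //.
  apply: submx_trans (capmxSr _ _) _; rewrite submxE.
  exact/eqP/mulmx_ker.
rewrite -(eqmxMr _ W12); apply: submx_trans; first by rewrite addsmxMr.
by rewrite mulmx_coker addsmx_sub sub0mx submx_refl.
Qed.

(** Inside the d-th component beta x is chi^d(x) block d (lambda x), and a
    projection T along W1 turns the action of block d on W2 / W1 into matrices. *)
Lemma subquotient_twisted d (W1 W2 : 'M[K]_r) m (tau : Gm U n -> 'M[U]_m) :
  subquotient iota beta W1 W2 tau -> (W2 <= component d)%MS ->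
  exists2 A, diff_rep iota A & forall x, point x -> tau x = twist d A x.
Proof.
move=> [W1st W2st W12 [B [BW2 rank2 tauE]]] W2d.
have [T [W1T BT]] := subquotient_projection BW2 rank2.
have W1d := submx_trans W12 W2d.
have BW : (B <= W2)%MS by move/eqmxP: BW2 => <-; exact: addsmxSr.
have Bd := submx_trans BW W2d.
have W1T0 p (v : 'M[U]_(p, r)) : (v <= W1^i)%MS -> v *m T^i = 0.
  by case/submxP=> u ->; rewrite -mulmxA -map_mxM W1T map_mx0 mulmx0.
pose A a := (B^i *m (block d a)^T *m T^i)^T.
have AE a : A a = (T^T)^i *m block d a *m (B^T)^i.
  by rewrite /A (trmx_mul _ T^i) (trmx_mul B^i) trmxK !map_trmx mulmxA.
exists A; last first.
  move=> x x0; apply: trmx_inj; rewrite /twist /A [RHS]linearZ /= trmxK.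
  rewrite scalemxAl -(beta_component Bd x0).
  have := W1T0 _ _ (tauE x x0); rewrite mulmxBl => /eqP; rewrite subr_eq0 => /eqP->.
  by rewrite -mulmxA -map_mxM BT map_mx1 mulmx1.
apply: Ga_rep_intro => [|a b|i j].
- by apply: trmx_inj; rewrite /A trmxK trmx1 component_id // -map_mxM BT map_mx1.
- apply: trmx_inj; rewrite [RHS]trmx_mul /A !trmxK.
  have : (B^i *m (block d b)^T <= ((W1 + B)%MS)^i)%MS.
    have W2sum : (W2 <= W1 + B)%MS by rewrite (eqmxP BW2).
    apply: submx_trans (_ : (_ <= W2^i)%MS) _; last by rewrite map_submx.
    apply: submx_trans (component_stable_block b W2d W2st).
    by apply: submxMr; rewrite map_submx.
  rewrite map_addsmx => /sub_addsmxP[[u v] /= BE].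
  have BET : B^i *m (block d b)^T *m T^i = v.
    rewrite BE mulmxDl -mulmxA -map_mxM W1T map_mx0 mulmx0 add0r.
    by rewrite -mulmxA -map_mxM BT map_mx1 mulmx1.
  have -> : block d (a + b) = block d a *m block d b by rewrite block_mul eqxx.
  rewrite BET (trmx_mul (block d a)) mulmxA BE !mulmxDl.
  rewrite -[u *m _ *m _]mulmxA -[u *m _ *m _]mulmxA.
  rewrite (W1T0 _ _ (component_stable_block _ W1d W1st)) mulmx0 add0r.
  by rewrite -!mulmxA.
- pose A' a := (T^T *m C d)^i *m alpha d a *m (R d *m B^T)^i.
  apply: (@coordinate_ext _ _ iota (Ga U n) (fun a => A' a i j)).
    by move=> a _; rewrite /A' AE /block !map_mxM !mulmxA.
  apply: coordinate_mulmx => k l; have [_ _ ca] := alpha_rep d; exact: ca.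
Qed.

(** A vector fixed by A is an eigenvector of tau with eigenvalue chi^d. *)
Lemma twisted_eigenvector d m (tau : Gm U n -> 'M[U]_m) A : (0 < m)%N ->
  diff_rep iota A -> (forall x, point x -> tau x = twist d A x) ->
  exists2 w : 'rV[K]_m, w != 0 &
    forall x, point x -> w^i *m (tau x)^T = chi d x *: w^i.
Proof.
move=> m_gt0 Arep tauE; have [_ _ cA] := Arep.
have [t der_t] := exists_unit_derivative U_closed.
have Atr : diff_rep iota (fun a => (A a)^T).
  apply: Ga_rep_intro => [|a b|i j]; first by rewrite (Ga_rep0 Arep) trmx1.
    by rewrite (Ga_repD Arep) (Ga_rep_comm Arep) trmx_mul.
  by apply: coordinate_ext (cA j i) => a _; rewrite mxE.
have [w w0 wfix] := Ga_rep_fixed_vector charU Atr der_t m_gt0.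
exists w => // x x0; rewrite tauE // /twist linearZ /= -scalemxAr.
by rewrite wfix.
Qed.

Lemma component_eigenvector d (Z : 'M[K]_r) :
  Z != 0 -> (Z <= component d)%MS -> subrep iota beta Z ->
  exists u : 'rV[K]_r, [/\ u != 0, (u <= Z)%MS
    & forall x, point x -> u^i *m (beta x)^T = chi d x *: u^i].
Proof.
move=> Z0 Zd Zst; set B := row_base Z.
have BZ : (B <= Z)%MS by rewrite eq_row_base.
pose tau x := (B^i *m (beta x)^T *m (pinvmx B)^i)^T.
have tauB x : point x -> (tau x)^T *m B^i = B^i *m (beta x)^T.
  move=> x0; rewrite trmxK map_pinvmx mulmxKpV //.
  have BZi : (B^i <= Z^i)%MS by rewrite map_submx.
  apply: submx_trans (submxMr (beta x)^T BZi) _.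
  by apply: submx_trans (Zst x x0) _; rewrite map_submx eq_row_base.
have tau_sub : subquotient iota beta 0 Z tau.
  split=> [x _|//||]; rewrite ?map_mx0 ?mul0mx ?sub0mx //.
  exists B; split=> [||x x0]; last by rewrite tauB // subrr sub0mx.
    by apply/eqmxP; apply: eqmx_trans (adds0mx _ _) (eq_row_base Z).
  by rewrite mxrank0.
have [A Arep tauE] := subquotient_twisted tau_sub Zd.
have rankZ : (0 < \rank Z)%N by rewrite lt0n mxrank_eq0.
have [w w0 weig] := twisted_eigenvector rankZ Arep tauE.
exists (w *m B); split=> [||x x0].
- apply: contraNneq w0 => wB0; apply/eqP/(row_free_inj (row_base_free Z)).
  by rewrite /= -/B wB0 mul0mx.
- exact: submx_trans (submxMl _ _) BZ.
- by rewrite map_mxM -mulmxA -tauB // mulmxA weig // -scalemxAl.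
Qed.

(** A simple subquotient is spanned by an eigenvector of character chi^d. *)
Lemma component_isotypic d : isotypic iota d beta (component d).
Proof.
move=> W1 W2 m tau W2d tau_sub [m_gt0 tau_simple].
have [A Arep tauE] := subquotient_twisted tau_sub W2d.
have [w w0 weig] := twisted_eigenvector m_gt0 Arep tauE.
have tau_w : subrep iota tau <<w>>%MS.
  move=> x x0; have wE := eqmx_trans (map_genmx iota w) (genmxE w^i).
  rewrite wE (eqmxMr _ wE) weig //.
  exact: scalemx_sub.
have m1 : m = 1%N.
  have [w'0|] := tau_simple _ tau_w.
    have : \rank <<w>>%MS = \rank w by rewrite genmxE.
    rewrite w'0 mxrank0 => /esym/eqP.
    by rewrite mxrank_eq0 (negPf w0).
  rewrite /row_full genmxE => /eqP rank_w; apply/eqP; rewrite eqn_leq m_gt0 andbT.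
  by rewrite -rank_w rank_leq_row.
subst m.
apply/rep_equivP; exists 1%:M, 1%:M; rewrite mulmx1 map_mx1; split=> // x x0.
rewrite mul1mx mulmx1; apply/matrixP => i j; rewrite !ord1 !mxE eqxx.
have /matrixP/(_ 0 0) := weig x x0; rewrite !mxE big_ord1 !mxE mulrC => /mulIf -> //.
rewrite fmorph_eq0; apply: contraNneq w0 => w00; apply/eqP/rowP => k.
by rewrite ord1 w00 mxE.
Qed.

(** Independence of the characters separates the condition that beta x preserves W
    into one condition for each block. *)
Lemma subrep_block d (W : 'M[K]_r) a :
  subrep iota beta W -> (W^i *m (block d a)^T <= W^i)%MS.
Proof.
move=> Wst; have [ds|ds] := boolP (d \in s); last first.
  by rewrite block_eq0 // trmx0 mulmx0 sub0mx.
rewrite submxE; apply/eqP.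
apply: (chi_logder_inj charU U_closed (B := fun _ _ => 0)
  (A := fun d a => W^i *m (block d a)^T *m cokermx W^i) uniq_s) => // x x0.
rewrite [RHS]big1 => [|e _]; last by rewrite scaler0.
have := Wst x x0; rewrite submxE sum_blocks // => /eqP E; rewrite -[RHS]E.
rewrite linear_sum mulmx_sumr mulmx_suml; apply: eq_bigr => e _.
by rewrite linearZ /= -scalemxAr -scalemxAl.
Qed.

(** The projections of W to the components lie in W. A nonzero projection to the
    e-th component would contain an eigenline of character chi^e, a simple
    subquotient of W, and chi^e = chi^d forces e = d. *)
Lemma isotypic_sub_component d (W : 'M[K]_r) :
  subrep iota beta W -> isotypic iota d beta W -> (W <= component d)%MS.
Proof.
move=> Wst Wiso; have [_ _ CR1 _] := beta_split.
have -> : W = \sum_(e <- s) W *m component e.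
  by rewrite -mulmx_sumr -[LHS]mulmx1 -trmx1 -CR1 linear_sum.
apply: summx_sub => e _; have [->|ed] := eqVneq e d; first exact: submxMl.
suff -> : W *m component e = 0 by exact: sub0mx.
apply/eqP; apply: contraNT ed => Z0; set Z := W *m component e in Z0.
have ZW : (Z <= W)%MS.
  by rewrite -(map_submx iota) map_mxM component_map subrep_block.
have Ze : (Z <= component e)%MS by exact: submxMl.
have Zst : subrep iota beta Z.
  move=> x x0; rewrite (beta_component Ze x0); apply: scalemx_sub.
  rewrite /Z map_mxM component_map -mulmxA -trmx_mul block_mul eqxx addr0.
  have -> : block e (logder x) = block e 0 *m block e (logder x).
    by rewrite block_mul eqxx add0r.
  by rewrite (trmx_mul (block e 0)) mulmxA submxMr // subrep_block.
have [u [u0 uZ ueig]] := component_eigenvector Z0 Ze Zst.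
have wE := eqmx_trans (map_genmx iota u) (genmxE u^i).
have sub_u : subquotient iota beta 0 <<u>>%MS (fun x => (chi e x)%:M : 'M_1).
  split=> [x _|x x0||].
  - by rewrite map_mx0 mul0mx sub0mx.
  - by rewrite wE (eqmxMr _ wE) ueig //; exact: scalemx_sub.
  - exact: sub0mx.
  exists u; split=> [||x x0].
  - by apply/eqmxP; apply: eqmx_trans (adds0mx _ _) (eqmx_sym (genmxE u)).
  - by rewrite mxrank0 genmxE rank_rV u0.
  - by rewrite ueig // tr_scalar_mx mul_scalar_mx subrr sub0mx.
have simple_chi : simple_rep iota (fun x : Gm U n => (chi e x)%:M : 'M_1).
  split=> // V _; have [->|V0] := eqVneq V 0; first by left.
  by right; rewrite /row_full rank_rV V0.
have /rep_equivP[X [Y [XY _ eqv]]] :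
    rep_equiv iota (fun x : Gm U n => (chi e x)%:M : 'M_1)
                   (fun x : Gm U n => (chi d x)%:M : 'M_1).
  by apply: Wiso sub_u simple_chi; rewrite genmxE (submx_trans uZ ZW).
apply: contraT => /(chi_separated charU)[c c_const /eqP[]].
have c0 : point c by apply/GmP => i; case: (c_const i).
have := eqv c c0; rewrite scalar_mxC -mulmxA -map_mxM XY map_mx1 mulmx1.
by move=> /matrixP/(_ 0 0); rewrite !mxE.
Qed.

Lemma component_is_isotypic_component d :
  isotypic_component iota d beta (component d).
Proof.
split=> [||W]; [exact: component_subrep|exact: component_isotypic|].
exact: isotypic_sub_component.
Qed.

Lemma component_subquotient d :
  subquotient iota beta 0 (component d) (twist d (alpha d)).
Proof.
have [RC1 _ _ _] := beta_split.
have RfC : row_free (C d)^T.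
  by apply/row_freeP; exists (R d)^T; rewrite -trmx_mul RC1 trmx1.
have CE : ((C d)^T == component d)%MS.
  rewrite /component trmx_mul submxMl andbT.
  by apply/submxP; exists (C d)^T; rewrite mulmxA -trmx_mul RC1 trmx1 mul1mx.
split=> [x _|||].
- by rewrite map_mx0 mul0mx sub0mx.
- exact: component_subrep.
- exact: sub0mx.
exists (C d)^T; split=> [||x x0].
- by apply/eqmxP; apply: eqmx_trans (adds0mx _ _) (eqmxP CE).
- by rewrite mxrank0 -(eqmxP CE) (eqP RfC).
have Cd : ((C d)^T <= component d)%MS by rewrite (eqmxP CE).
rewrite (beta_component Cd x0) /twist linearZ /= -scalemxAl -scalerBr.
rewrite -map_trmx /block -!trmx_mul -!mulmxA -map_mxM RC1 map_mx1 mulmx1.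
by rewrite subrr scaler0 sub0mx.
Qed.

End Blocks.

Lemma mul_sum_orthogonal (F : pzRingType) r k (A B : 'I_k -> 'M[F]_r) :
  (forall i j, i != j -> A i *m B j = 0) ->
  (\sum_i A i) *m (\sum_i B i) = \sum_i A i *m B i.
Proof.
move=> AB; rewrite mulmx_suml; apply: eq_bigr => i _.
by rewrite mulmx_sumr (bigD1 i) //= big1 ?addr0 // => j ji; rewrite AB // eq_sym.
Qed.

(** Both splittings are summed over the union t of their supports. An equivalence
    of beta and beta' conjugates the blocks, which restricts to maps between the
    summands; conversely equivalences of the summands add up. *)
Lemma splitting_equiv r (beta beta' : Gm U n -> 'M[U]_r) (s s' : seq weight)
    (rd rd' : weight -> nat)
    (alpha : forall d, Ga U n -> 'M[U]_(rd d))
    (alpha' : forall d, Ga U n -> 'M[U]_(rd' d)) C R C' R' :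
  uniq s -> uniq s' ->
  (forall d, d \notin s -> rd d = 0%N) ->
  (forall d, d \notin s' -> rd' d = 0%N) ->
  (forall d, diff_rep iota (alpha d)) -> (forall d, diff_rep iota (alpha' d)) ->
  splitting iota beta s alpha C R -> splitting iota beta' s' alpha' C' R' ->
  rep_equiv iota beta beta' <-> forall d, rep_equiv iota (alpha d) (alpha' d).
Proof.
move=> us us' rd0 rd0' ar ar' spl spl'; pose t := undup (s ++ s').
have st : {subset s <= t} by move=> d ds; rewrite mem_undup mem_cat ds.
have st' : {subset s' <= t} by move=> d ds; rewrite mem_undup mem_cat ds orbT.
have ut : uniq t by exact: undup_uniq.
have [RC1 RC0 CR bE] := spl; have [RC1' RC0' CR' bE'] := spl'.
have tE x : point x ->
    beta x = \sum_(d <- t) chi d x *: block alpha C R d (logder x).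
  move=> x0; rewrite (sum_blocks spl) // -(big_uniq_subset us ut st) // => d ds.
  by rewrite (block_eq0 _ _ _ rd0 _ ds) ?scaler0.
have tE' x : point x ->
    beta' x = \sum_(d <- t) chi d x *: block alpha' C' R' d (logder x).
  move=> x0; rewrite (sum_blocks spl') // -(big_uniq_subset us' ut st') // => d ds.
  by rewrite (block_eq0 _ _ _ rd0' _ ds) ?scaler0.
have tCR : \sum_(d <- t) C d *m R d = 1%:M.
  rewrite -CR (big_uniq_subset us ut st) // => d ds.
  by rewrite (_ : C d = 0) ?mul0mx //; apply: mx_dim0; right; exact: rd0.
have tCR' : \sum_(d <- t) C' d *m R' d = 1%:M.
  rewrite -CR' (big_uniq_subset us' ut st') // => d ds.
  by rewrite (_ : C' d = 0) ?mul0mx //; apply: mx_dim0; right; exact: rd0'.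
split=> [/rep_equivP[X [Y [XY YX XYE]]] d|equiv].
  have blockE a : block alpha' C' R' d a = X^i *m block alpha C R d a *m Y^i.
    have [dt|dt] := boolP (d \in t); last first.
      have ds : d \notin s by apply: contra dt; exact: st.
      have ds' : d \notin s' by apply: contra dt; exact: st'.
      rewrite (block_eq0 _ _ _ rd0 _ ds) (block_eq0 _ _ _ rd0' _ ds').
      by rewrite mulmx0 mul0mx.
    apply: (chi_logder_inj charU U_closed
      (A := fun d a => block alpha' C' R' d a)
      (B := fun d a => X^i *m block alpha C R d a *m Y^i) ut) => // x x0.
    rewrite -tE' // XYE // tE // mulmx_sumr mulmx_suml.
    by apply: eq_bigr => e _; rewrite -scalemxAr -scalemxAl.
  have E0 : C' d *m R' d = X *m (C d *m R d) *m Y.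
    apply: (@map_mx_inj _ _ iota).
    by rewrite -(block0 C' R' ar') blockE (block0 C R ar) !map_mxM.
  apply/rep_equivP; exists (R' d *m X *m C d), (R d *m Y *m C' d); split.
  - have -> : R' d *m X *m C d *m (R d *m Y *m C' d)
        = R' d *m (X *m (C d *m R d) *m Y) *m C' d by rewrite !mulmxA.
    by rewrite -E0 !mulmxA RC1' mul1mx RC1'.
  - have -> : R d *m Y *m C' d *m (R' d *m X *m C d)
        = R d *m (Y *m (C' d *m R' d) *m X) *m C d by rewrite !mulmxA.
    have -> : Y *m (C' d *m R' d) *m X = C d *m R d.
      by rewrite E0 !mulmxA YX mul1mx -mulmxA YX mulmx1.
    by rewrite mulmxA RC1 mul1mx RC1.
  - move=> a _.
    have -> : alpha' d a = (R' d)^i *m block alpha' C' R' d a *m (C' d)^i.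
      rewrite /block !mulmxA -map_mxM RC1' map_mx1 mul1mx.
      by rewrite -mulmxA -map_mxM RC1' map_mx1 mulmx1.
    by rewrite blockE /block !map_mxM !mulmxA.
(* Indexing by the finite type of positions in t allows a choice of all the
   conjugating matrices at once. *)
have /fin_all_exists[X /fin_all_exists[Y XYP]] (i : 'I_(size t)) :
    exists X Y, [/\ X *m Y = 1%:M, Y *m X = 1%:M
      & forall a, alpha' t`_i a = X^i *m alpha t`_i a *m Y^i].
  have /rep_equivP[X [Y [XY YX XYE]]] := equiv t`_i.
  by exists X, Y; split=> // a; exact: XYE.
have t_inj (i j : 'I_(size t)) : i != j -> t`_i != t`_j.
  by apply: contraNneq => /eqP; rewrite nth_uniq.
apply/rep_equivP.
exists (\sum_(i < size t) C' t`_i *m X i *m R t`_i).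
exists (\sum_(i < size t) C t`_i *m Y i *m R' t`_i).
split=> [||x x0].
- rewrite mul_sum_orthogonal => [|i j ij]; last first.
    rewrite !mulmxA -(mulmxA (C' _ *m X i)) RC0 ?t_inj //.
    by rewrite mulmx0 !mul0mx.
  rewrite -tCR' big_seq_ord; apply: eq_bigr => i _; have [XY _ _] := XYP i.
  by rewrite !mulmxA -(mulmxA (C' _ *m X i)) RC1 mulmx1 -(mulmxA (C' _)) XY mulmx1.
- rewrite mul_sum_orthogonal => [|i j ij]; last first.
    rewrite !mulmxA -(mulmxA (C _ *m Y i)) RC0' ?t_inj //.
    by rewrite mulmx0 !mul0mx.
  rewrite -tCR big_seq_ord; apply: eq_bigr => i _; have [_ YX _] := XYP i.
  by rewrite !mulmxA -(mulmxA (C _ *m Y i)) RC1' mulmx1 -(mulmxA (C _)) YX mulmx1.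
- rewrite !(raddf_sum (map_mx iota)) mulmx_suml.
  pose M (i : 'I_(size t)) := chi t`_i x *:
    ((C' t`_i *m X i)^i *m alpha t`_i (logder x) *m (R t`_i)^i).
  rewrite (eq_bigr M) => [|i _]; last first.
    by rewrite /= map_mxM -mulmxA (row_beta us rd0 spl) // -scalemxAr mulmxA.
  rewrite mul_sum_orthogonal => [|i j ij]; last first.
    rewrite /M /= -scalemxAl -(mulmxA _ (R _)^i) -map_mxM !mulmxA RC0 ?t_inj //.
    by rewrite !mul0mx map_mx0 mulmx0 scaler0.
  rewrite tE' // big_seq_ord; apply: eq_bigr => i _; have [_ _ XYE] := XYP i.
  rewrite /M /block /= -scalemxAl -(mulmxA _ (R _)^i) -map_mxM !mulmxA RC1 mul1mx XYE.
  by rewrite !map_mxM !mulmxA.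
Qed.

End TorusRepresentations.

(** * The structure theorem *)

Theorem theorem4p3 (K U : diffFieldType) (iota : {rmorphism K -> U})
    (charK : [pchar K] =i pred0) (iota_diff : diff_morphism iota)
    (U_closed : diff_closed U) (n : nat) (n_gt0 : (0 < n)%N) (r : nat) :
  (forall beta : Gm U n -> 'M[U]_r, diff_rep iota beta ->
     exists (s : seq {ffun 'I_n -> int}) (rd : {ffun 'I_n -> int} -> nat)
            (alpha : forall d, Ga U n -> 'M[U]_(rd d)),
       decomposition iota beta s alpha /\
       forall d, exists W : 'M[K]_r,
         isotypic_component iota d beta W /\
         subquotient iota beta 0 W (twist d (alpha d)))
  /\
  (forall beta beta' : Gm U n -> 'M[U]_r,
     diff_rep iota beta -> diff_rep iota beta' ->
     forall (s s' : seq {ffun 'I_n -> int}) (rd rd' : {ffun 'I_n -> int} -> nat)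
            (alpha : forall d, Ga U n -> 'M[U]_(rd d))
            (alpha' : forall d, Ga U n -> 'M[U]_(rd' d)),
       decomposition iota beta s alpha -> decomposition iota beta' s' alpha' ->
       (rep_equiv iota beta beta' <->
        forall d, rep_equiv iota (alpha d) (alpha' d))).
Proof.
have charU : [pchar U] =i pred0 by move=> p; rewrite (fmorph_pchar iota) charK.
split=> [beta beta_rep|beta beta' _ _ s s' rd rd' alpha alpha'].
  have [s [rd [alpha dec]]] := splitting_exists charU iota_diff U_closed beta_rep.
  have [uniq_s rd0 alpha_rep [C [R spl]]] := dec.
  exists s, rd, alpha; split=> [|d]; first exact/decompositionP.
  exists (component C R d); split.
    exact: component_is_isotypic_component spl _.
  exact: component_subquotient spl _.
move=> /decompositionP[uniq_s rd0 alpha_rep [C [R spl]]].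
move=> /decompositionP[uniq_s' rd0' alpha_rep' [C' [R' spl']]].
exact: splitting_equiv spl spl'.
Qed.
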